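(* Let $\Sigma$ be a signature and $\mathcal C\subseteq\mathrm{STR}[\Sigma]$. Then: (a) $\mathcal C\sqsubseteq_{\mathrm{in}}\mathcal P$ if and only if $\mathrm{pwd}(\mathcal C)<\infty$; (b) $\mathcal C\sqsubseteq_{\mathrm{in}}\mathcal T_\omega$ if and only if $\mathrm{twd}(\mathcal C)<\infty$; (c) for every $n\in\mathbb N$, $\mathcal C\sqsubseteq_{\mathrm{in}}\mathcal T_n$ if and only if $\mathrm{twd}_n(\mathcal C)<\infty$.
   Context: All structures and trees are finite, possibly empty, and identified up to isomorphism. A signature is a finite set of relation symbols of arity $\ge 1$; $\mathrm{STR}[\Sigma]$ is the class of all finite $\Sigma$-structures. Incidence structures. For $\mathfrak A=\langle A,R_0^{\mathfrak A},\dots,R_{m-1}^{\mathfrak A}\rangle$ with maximal arity $r$, let $\mathfrak A_{\mathrm{in}}:=\langle A\mathbin{\dot\cup}E,P_{R_0},\dots,P_{R_{m-1}},\mathrm{in}_0,\dots,\mathrm{in}_{r-1}\rangle$ where $E:=R_0^{\mathfrak A}\cup\dots\cup R_{m-1}^{\mathfrak A}$ (one new element for each tuple), $P_{R_i}:=\{\bar c\in E:\bar c\in R_i^{\mathfrak A}\}$, $\mathrm{in}_i:=\{(a,\bar c)\in A\times E:|\bar c|>i,\ a=c_i\}$. Put $\mathcal C_{\mathrm{in}}:=\{\mathfrak A_{\mathrm{in}}:\mathfrak A\in\mathcal C\}$. Transductions. MSO is monadic second-order logic. $\mathrm{copy}_1(\mathfrak A):=\mathfrak A$; for $k\ge2$,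 $\mathrm{copy}_k(\mathfrak A)$ is the disjoint union of $k$ copies of $\mathfrak A$ (elements $\langle a,i\rangle$) expanded by the unary relations $P_i:=\{\langle a,i\rangle:a\in A\}$, $i<k$, and $\langle a,i\rangle\sim\langle b,j\rangle:\Leftrightarrow a=b$. $\mathrm{exp}_m$ (many-valued) maps $\mathfrak A$ to all its expansions by $m$ arbitrary unary predicates. A basic MSO-transduction is the partial map given by MSO-formulae $\langle\chi,\delta(x),\varphi_0(\bar x),\dots,\varphi_{s-1}(\bar x)\rangle$: defined on $\mathfrak A$ iff $\mathfrak A\models\chi$, with value $\langle D,R_0,\dots,R_{s-1}\rangle$, $D=\{a\in A:\mathfrak A\models\delta(a)\}$, $R_i=\{\bar a\in D^{\mathrm{ar}(R_i)}:\mathfrak A\models\varphi_i(\bar a)\}$. A transduction is an operation $\tau=\tau_0\circ\mathrm{copy}_k\circ\mathrm{exp}_m$ with $\tau_0$ basic; $\tau(\mathfrak A)$ is the set of all its values on $\mathfrak A$, and $\tau(\mathcal C):=\bigcup_{\mathfrak A\in\mathcal C}\tau(\mathfrak A)$. $\mathcal C\sqsubseteq_{\mathrm{in}}\mathcal K$ iff $\mathcal C_{\mathrm{in}}\subseteq\tau(\mathcal K_{\mathrm{in}})$ for some transduction $\tau$. Trees. A tree domain is a finite prefix-closed set $T$ of finite sequences; the successor-tree on $T$ is $\langle T,\mathrm{edg}\rangle$ with $(x,y)\in\mathrm{edg}$ iff $y=xd$ for some single element $d$. The height of a tree is the number of its levels (empty tree: 0; single vertex: 1). $m^{<n}$ is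 the complete $m$-ary tree of height $n$ (all sequences over $\{0,\dots,m-1\}$ of length $<n$). $\mathcal T_n:=\{m^{<n}:m\in\mathbb N\}$ (as successor-trees), $\mathcal T_\omega$ is the class of all successor-trees, $\mathcal P$ the class of all paths (successor-trees in which each vertex has at most one successor). Widths. A tree decomposition of $\mathfrak A$ is a family $D=(U_v)_{v\in T}$ of (possibly empty) subsets $U_v\subseteq A$ indexed by a rooted tree $T$ (the underlying tree) such that for every $a\in A$ the set $\{v\in T:a\in U_v\}$ is nonempty and connected in $T$, and every tuple in a relation of $\mathfrak A$ has all its components in some $U_v$. Its width is $\sup_{v\in T}(|U_v|-1)$ (taken to be $-1$ for the empty tree). $\mathrm{twd}(\mathfrak A)$ is the minimal width of a tree decomposition of $\mathfrak A$; $\mathrm{pwd}(\mathfrak A)$ the minimal width of one whose underlying tree is a path; $\mathrm{twd}_n(\mathfrak A)$ the minimal width of one whose underlying tree has height at most $n$ ($\infty$ if there is none). For a class $\mathcal C$, $\mathrm{twd}(\mathcal C),\mathrm{pwd}(\mathcal C),\mathrm{twd}_n(\mathcal C)$ are the suprema over $\mathfrak A\in\mathcal C$. *)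

(* Defs.v *)
From mathcomp Require Import all_boot all_order all_algebra finmap.
From mathcomp Require Import boolp classical_sets constructive_ereal.

Set Implicit Arguments.
Unset Strict Implicit.
Unset Printing Implicit Defensive.

Import Order.TTheory GRing.Theory Num.Theory.

Record signature := Signature {
  symbol : finType;
  arity : symbol -> nat;
  arity_gt0 : forall R, 0 < arity R
}.

Record structure (S : signature) := Structure {
  carrier :> finType;
  interp : forall R : symbol S, {set (arity R).-tuple carrier}
}.

(* Not [set (structure S)], which is a universe inconsistency.  Classes are not
   required to be closed under isomorphism; instead, structures are compared up
   to [iso] in [incidence_class] and [transduce]. *)
Definition class (S : signature) : Type := structure S -> Prop.

Definition iso (S : signature) (A B : structure S) : Prop :=
  exists2 f : A -> B, bijective f &
    forall (R : symbol S) (t : (arity R).-tuple A),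
      (map_tuple f t \in interp B R) = (t \in interp A R).

Definition max_arity (S : signature) : nat := \max_(R : symbol S) arity R.

Definition incidence_arity (S : signature)
    (s : symbol S + 'I_(max_arity S)) : nat :=
  match s with inl _ => 1 | inr _ => 2 end.

Lemma incidence_arity_gt0 (S : signature) (s : symbol S + 'I_(max_arity S)) :
  0 < incidence_arity s.
Proof. by case: s. Qed.

(* [inl R] is the unary symbol P_R and [inr i] the binary symbol in_i. *)
Definition incidence_sig (S : signature) : signature :=
  Signature (@incidence_arity_gt0 S).

Definition seq_in (S : signature) (A : structure S) (R : symbol S)
    (c : seq A) : bool :=
  [exists t in interp A R, tval t == c].

(* The union of all relations.  As a union of sets of sequences, it contains a
   sequence belonging to several relations only once. *)
Definition tuples (S : signature) (A : structure S) : finType :=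
  {c : (max_arity S).-bseq A | [exists R, seq_in R c]}.

Definition incidence_interp (S : signature) (A : structure S)
    (s : symbol (incidence_sig S)) : {set (arity s).-tuple (A + tuples A)%type} :=
  match s return {set (incidence_arity s).-tuple (A + tuples A)%type} with
  | inl R => [set t : 1.-tuple (A + tuples A)%type |
      if thead t is inr c then seq_in R (val c) else false]
  | inr i => [set t : 2.-tuple (A + tuples A)%type |
      if (tnth t ord0, tnth t ord_max) is (inl a, inr c)
      then onth (val c) i == Some a else false]
  end.

Definition incidence (S : signature) (A : structure S) :
    structure (incidence_sig S) :=
  Structure (@incidence_interp S A).

Definition incidence_class (S : signature) (C : class S) :
    class (incidence_sig S) :=
  fun B => exists2 A, C A & iso (incidence A) B.

(* [mso S n k]: formulae whose free element variables are indexed by ['I_n] and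
   whose free set variables are indexed by ['I_k].  A quantifier binds the
   variable of index 0 and shifts the other ones. *)
Inductive mso (S : signature) : nat -> nat -> Type :=
| MEq n k (x y : 'I_n) : mso S n k
| MRel n k (R : symbol S) (x : (arity R).-tuple 'I_n) : mso S n k
| MMem n k (x : 'I_n) (X : 'I_k) : mso S n k
| MNot n k (phi : mso S n k) : mso S n k
| MAnd n k (phi psi : mso S n k) : mso S n k
| MExElt n k (phi : mso S n.+1 k) : mso S n k
| MExSet n k (phi : mso S n k.+1) : mso S n k.

Fixpoint sat (S : signature) (A : structure S) (n k : nat) (phi : mso S n k) :
    n.-tuple A -> k.-tuple {set A} -> bool :=
  match phi in mso _ n k return n.-tuple A -> k.-tuple {set A} -> bool with
  | MEq _ _ x y => fun v V => tnth v x == tnth v y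
  | MRel _ _ R x => fun v V => map_tuple (tnth v) x \in interp A R
  | MMem _ _ x X => fun v V => tnth v x \in tnth V X
  | MNot _ _ phi => fun v V => ~~ sat phi v V
  | MAnd _ _ phi psi => fun v V => sat phi v V && sat psi v V
  | MExElt _ _ phi => fun v V => [exists a : A, sat phi [tuple of a :: v] V]
  | MExSet _ _ phi => fun v V => [exists X : {set A}, sat phi v [tuple of X :: V]]
  end.

Definition exp_arity (S : signature) (m : nat) (s : symbol S + 'I_m) : nat :=
  match s with inl R => arity R | inr _ => 1 end.

Lemma exp_arity_gt0 (S : signature) (m : nat) (s : symbol S + 'I_m) :
  0 < exp_arity s.
Proof. by case: s => [R|i] //=; apply: arity_gt0. Qed.

Definition exp_sig (S : signature) (m : nat) : signature :=
  Signature (@exp_arity_gt0 S m).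

Definition expand_interp (S : signature) (A : structure S) (m : nat)
    (P : 'I_m -> {set A}) (s : symbol (exp_sig S m)) : {set (arity s).-tuple A} :=
  match s return {set (exp_arity s).-tuple A} with
  | inl R => interp A R
  | inr i => [set t : 1.-tuple A | thead t \in P i]
  end.

Definition expand (S : signature) (A : structure S) (m : nat)
    (P : 'I_m -> {set A}) : structure (exp_sig S m) :=
  Structure (expand_interp P).

Definition labelled_copy_arity (S : signature) (k : nat)
    (s : symbol S + option 'I_k) : nat :=
  match s with inl R => arity R | inr (Some _) => 1 | inr None => 2 end.

Lemma labelled_copy_arity_gt0 (S : signature) (k : nat)
    (s : symbol S + option 'I_k) : 0 < labelled_copy_arity s.
Proof. by case: s => [R|[i|]] //=; apply: arity_gt0. Qed.

(* [inr (Some i)] is the unary symbol P_i and [inr None] the binary symbol ~. *)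
Definition labelled_copy_sig (S : signature) (k : nat) : signature :=
  Signature (@labelled_copy_arity_gt0 S k).

Definition labelled_copy_interp (S : signature) (k : nat) (A : structure S)
    (s : symbol (labelled_copy_sig S k)) :
    {set (arity s).-tuple (A * 'I_k)%type} :=
  match s return {set (labelled_copy_arity s).-tuple (A * 'I_k)%type} with
  | inl R => [set t : (arity R).-tuple (A * 'I_k)%type |
      (map_tuple fst t \in interp A R) && constant (map snd t)]
  | inr (Some i) => [set t : 1.-tuple (A * 'I_k)%type | (thead t).2 == i]
  | inr None => [set t : 2.-tuple (A * 'I_k)%type |
      (tnth t ord0).1 == (tnth t ord_max).1]
  end.

Definition labelled_copy (S : signature) (k : nat) (A : structure S) :
    structure (labelled_copy_sig S k) :=
  Structure (@labelled_copy_interp S k A).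

(* copy_1 is the identity and adds no relation; the value at 0 is irrelevant. *)
Definition copy_sig (S : signature) (k : nat) : signature :=
  match k with j.+2 => labelled_copy_sig S j.+2 | _ => S end.

Definition copy (S : signature) (k : nat) (A : structure S) :
    structure (copy_sig S k) :=
  match k return structure (copy_sig S k) with
  | j.+2 => labelled_copy j.+2 A
  | _ => A
  end.

Record basic_transduction (S S' : signature) := BasicTransduction {
  bt_chi : mso S 0 0;
  bt_delta : mso S 1 0;
  bt_phi : forall R : symbol S', mso S (arity R) 0
}.

Section BasicTransduction.
Variables (S S' : signature) (t : basic_transduction S S') (A : structure S).

Definition bt_defined : bool := sat (A := A) (bt_chi t) [tuple] [tuple].

Definition bt_domain : finType := {a : A | sat (bt_delta t) [tuple a] [tuple]}.

Definition bt_value : structure S' :=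
  @Structure S' bt_domain (fun R =>
    [set x : (arity R).-tuple bt_domain |
      sat (bt_phi t R) (map_tuple val x) [tuple]]).

End BasicTransduction.

Record transduction (S S' : signature) := Transduction {
  tr_exp : nat;
  tr_copy : nat;
  tr_copy_gt0 : 0 < tr_copy;
  tr_basic : basic_transduction (copy_sig (exp_sig S tr_exp) tr_copy) S'
}.

Definition transduce (S S' : signature) (t : transduction S S')
    (A : structure S) : class S' :=
  fun B => exists P : 'I_(tr_exp t) -> {set A},
    let A' := copy (tr_copy t) (expand P) in
    bt_defined (tr_basic t) A' /\ iso (bt_value (tr_basic t) A') B.

Definition transduce_class (S S' : signature) (t : transduction S S')
    (C : class S) : class S' :=
  fun B => exists2 A, C A & transduce t A B.

Definition incidence_transducible (S S' : signature)
    (C : class S) (K : class S') : Prop :=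
  exists t : transduction (incidence_sig S') (incidence_sig S),
    forall B, incidence_class C B -> transduce_class t (incidence_class K) B.

(* As trees are finite, it is enough to consider sequences of numbers. *)
Record tree_domain := TreeDomain {
  vertices :> {fset seq nat};
  prefix_closed : forall x y : seq nat,
    prefix x y -> y \in vertices -> x \in vertices
}.

Definition edge (x y : seq nat) : bool :=
  prefix x y && (size y == (size x).+1).

Lemma edgeP (x y : seq nat) : reflect (exists d, y = rcons x d) (edge x y).
Proof.
apply: (iffP andP) => [[/prefixP[s ->]]|[d ->]]; last first.
  by rewrite prefix_rcons size_rcons.
rewrite size_cat -addn1 eqn_add2l; case: s => [|d []] // _.
by exists d; rewrite cats1.
Qed.

Definition graph_sig : signature :=
  @Signature unit (fun=> 2) (fun=> isT).

Definition successor_tree (T : tree_domain) : structure graph_sig :=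
  @Structure graph_sig T (fun=> [set t : 2.-tuple T |
    edge (val (tnth t ord0)) (val (tnth t ord_max))]).

Definition height (T : tree_domain) : nat := \max_(v : T) (size (val v)).+1.

Definition is_path (T : tree_domain) : Prop :=
  forall x y z : T, edge (val x) (val y) -> edge (val x) (val z) -> y = z.

Definition complete_vertices (m n : nat) : {fset seq nat} :=
  [fset [seq val d | d <- bseqval s]
    | s in [pred s : n.-bseq 'I_m | size s < n]]%fset.

Lemma in_complete_vertices (m n : nat) (x : seq nat) :
  (x \in complete_vertices m n) = (size x < n) && all (fun d => d < m) x.
Proof.
apply/imfsetP/andP => /= [[s]|[ltxn /allP ltxm]].
  rewrite -topredE /= => ltsn ->; rewrite size_map; split; first exact: ltsn.
  by apply/allP => _ /mapP[d _ ->]; apply: ltn_ord.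
pose s := pmap (insub : nat -> option 'I_m) x.
have sE : [seq val d | d <- s] = x.
  rewrite pmap_filter; last exact: insubK.
  by apply/all_filterP/allP => d /ltxm ltdm /=; rewrite insubT.
have szs : size s = size x by rewrite -[in RHS]sE size_map.
have lesn : size s <= n by rewrite szs ltnW.
by exists (Bseq lesn); [rewrite -topredE /= szs | rewrite -sE].
Qed.

Lemma complete_prefix_closed (m n : nat) (x y : seq nat) :
  prefix x y -> y \in complete_vertices m n -> x \in complete_vertices m n.
Proof.
move=> /prefixP[s ->]; rewrite !in_complete_vertices size_cat all_cat.
move=> /andP[ltn_sum /andP[-> _]]; rewrite andbT.
exact: leq_ltn_trans (leq_addr _ _) ltn_sum.
Qed.

Definition complete_tree (m n : nat) : tree_domain :=
  TreeDomain (@complete_prefix_closed m n).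

Definition trees : class graph_sig :=
  fun B => exists T : tree_domain, B = successor_tree T.

Definition paths : class graph_sig :=
  fun B => exists2 T : tree_domain, is_path T & B = successor_tree T.

Definition complete_trees (n : nat) : class graph_sig :=
  fun B => exists m : nat, B = successor_tree (complete_tree m n).

Definition tree_connected (T : tree_domain) (X : {set T}) : Prop :=
  {in X &, forall v w,
    connect [rel x y : T | [&& x \in X, y \in X &
      edge (val x) (val y) || edge (val y) (val x)]] v w}.

Record tree_decomposition (S : signature) (A : structure S) :=
  TreeDecomposition {
    underlying : tree_domain;
    bag : underlying -> {set A};
    bag_cover : forall a : A, exists v, a \in bag v;
    bag_connected : forall a : A, tree_connected [set v | a \in bag v];
    bag_tuple : forall (R : symbol S) (t : (arity R).-tuple A),
      t \in interp A R -> exists v, {subset t <= bag v}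
  }.

(* Bag sizes minus one are at least -1, so starting the maximum at -1 only
   settles the case of the empty tree. *)
Definition width (S : signature) (A : structure S) (D : tree_decomposition A) :
    int :=
  \big[Order.max/(-1)%R]_(v : underlying D) (#|bag v|%:Z - 1)%R.

(* Widths being integers bounded below, the infimum is attained unless no tree
   decomposition has an underlying tree satisfying Q; it is then +oo. *)
Definition min_width (Q : tree_domain -> Prop) (S : signature)
    (A : structure S) : \bar int :=
  infimum +oo%E
    (fun w => exists2 D : tree_decomposition A,
       Q (underlying D) & w = (width D)%:E%E).

Definition twd (S : signature) (A : structure S) : \bar int :=
  min_width (fun=> True) A.

Definition pwd (S : signature) (A : structure S) : \bar int :=
  min_width is_path A.

Definition twdn (n : nat) (S : signature) (A : structure S) : \bar int :=
  min_width (fun T => height T <= n) A.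

Definition class_width (S : signature) (wd : structure S -> \bar int)
    (C : class S) : \bar int :=
  supremum -oo%E (fun w => exists2 A, C A & w = wd A).

(* Main.v *)
Require Import Defs.
From mathcomp Require Import all_boot all_order all_algebra finmap.
From mathcomp Require Import boolp classical_sets constructive_ereal.
From mathcomp Require Import zify.

Set Implicit Arguments.
Unset Strict Implicit.
Unset Printing Implicit Defensive.

Import Order.TTheory.

(** All three equivalences are instances of one statement about a property Q of
trees and a class K of trees with property Q such that each tree with property
Q is contained in a member of K.

From a decomposition to a transduction.  Let D be a tree decomposition with
bags of size at most k, and T' a tree containing the underlying tree T of D.
Colour the elements of the structure by k colours, injectively on each bag.  An
element a is coded by the topmost vertex whose bag contains it and by its
colour; a tuple c by a vertex whose bag contains its components and by the word
of their colours.  A transduction has one copy of the tree for each colour and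
for each word, and unary predicates telling which vertices code something in
which copy.  The component of colour i of a tuple coded at v is the element
coded by the first vertex, on the way from v to the root, that introduces an
element of colour i: this can be expressed in MSO by closing a set of vertices
under parents.  The transduction depends on k only, and the vertices of T' not
in T code nothing (decoding_encodes).

From a transduction to a decomposition.  Each element of a transduced incidence
structure sits at a vertex of the tree T it comes from.  Let the bags containing
an element a be those along the paths from the vertex of a to the vertices of
the tuples that contain a.  This is a tree decomposition whose underlying tree
is T itself, so height and shape are preserved even when the branching of T is
unbounded.  Its bags are bounded: if a is in the bag of v without sitting at v,
then a and some tuple c containing it sit in different components of T minus v.
Now in a structure cut into parts that interact only through finitely many
colours, the truth of an MSO formula depends only on finitely many types of the
parts (sat_part_type).  Hence two elements with the same type in their
components are components of the same tuples, as far as the latter sit in a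
third component; since the j-th component of a tuple is unique, at most two
elements of each type can cross at v (card_crossing). *)

(** * Types of the parts of a structure *)

(** The values of the types of phi: a finite set that depends on phi and on the
set L of colours, but not on the structure, hence the uniform bounds below. *)
Fixpoint local_type (S : signature) (L : finType) n k (phi : mso S n k) :
    finType :=
  match phi with
  | MEq _ _ _ _ => bool
  | MRel _ _ R _ => ({ffun 'I_(arity R) -> option L} * bool)%type
  | MMem _ _ _ _ => bool
  | MNot _ _ phi => local_type L phi
  | MAnd _ _ phi psi => (local_type L phi * local_type L psi)%type
  | MExElt _ _ phi => ({set local_type L phi} * local_type L phi)%type
  | MExSet _ _ phi => {set local_type L phi}
  end.

Section LocalType.
Variables (S : signature) (L : finType) (A : structure S) (col : A -> L).

(** The contribution of the part K to the truth of phi.  In the valuation of the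
element variables, None stands for whatever lies outside K, so that a quantified
element is either in K or None.  A quantified set matters only through its trace
on K, see [eq_mso_type]. *)
Fixpoint mso_type (K : {set A}) n k (phi : mso S n k) :
    n.-tuple (option A) -> k.-tuple {set A} -> local_type L phi :=
  match phi in mso _ n k
  return n.-tuple (option A) -> k.-tuple {set A} -> local_type L phi with
  | MEq _ _ x y => fun v V => isSome (tnth v x) && (tnth v x == tnth v y)
  | MRel _ _ R x => fun v V =>
      ([ffun i => omap col (tnth v (tnth x i))],
       [exists t in interp A R, map_tuple some t == map_tuple (tnth v) x])
  | MMem _ _ x X => fun v V =>
      if tnth v x is Some a then (a \in K) && (a \in tnth V X) else false
  | MNot _ _ phi => fun v V => mso_type K phi v V
  | MAnd _ _ phi psi => fun v V => (mso_type K phi v V, mso_type K psi v V)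
  | MExElt _ _ phi => fun v V =>
      ([set mso_type K phi [tuple of Some a :: v] V | a in K],
       mso_type K phi [tuple of None :: v] V)
  | MExSet _ _ phi => fun v V =>
      [set mso_type K phi v [tuple of X :: V] | X : {set A}]
  end.

Definition restrict (K : {set A}) n (v : n.-tuple A) : n.-tuple (option A) :=
  map_tuple (fun a => if a \in K then Some a else None) v.

Lemma tnth_restrict K n (v : n.-tuple A) i :
  tnth (restrict K v) i = if tnth v i \in K then Some (tnth v i) else None.
Proof. exact: tnth_map. Qed.

Lemma restrict_cons (K : {set A}) a n (v : n.-tuple A) :
  restrict K [tuple of a :: v] =
  [tuple of (if a \in K then Some a else None) :: restrict K v].
Proof. exact: val_inj. Qed.

Lemma eq_mso_type (K : {set A}) n k (phi : mso S n k)
    v (V V' : k.-tuple {set A}) :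
  (forall i a, a \in K -> (a \in tnth V i) = (a \in tnth V' i)) ->
  mso_type K phi v V = mso_type K phi v V'.
Proof.
elim: phi v V V' => //= {n k}.
- move=> n k x X v V V' eqV; case: (tnth v x) => // a.
  by case: (boolP (a \in K)) => //= /eqV->.
- by move=> n k phi IH psi IH' v V V' eqV;
    rewrite (IH _ _ _ eqV) (IH' _ _ _ eqV).
- move=> n k phi IH v V V' eqV; rewrite (IH _ _ _ eqV); congr (_, _).
  by apply: eq_imset => a; apply: IH.
- move=> n k phi IH v V V' eqV; apply: eq_imset => X; apply: IH => i a aK.
  by case: (unliftP ord0 i) => [j|] ->; rewrite ?tnthS ?tnth0 //; apply: eqV.
Qed.

Definition part_type (J : eqType) (part : A -> J) (j : J) n k
    (phi : mso S n k) (v : n.-tuple A) (V : k.-tuple {set A}) :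
    local_type L phi :=
  mso_type [set a | part a == j] phi (restrict [set a | part a == j] v) V.

(** The parts interact through the colours only. *)
Definition local (J : eqType) (part : A -> J)
    (g : forall R : symbol S, (arity R).-tuple L -> bool) : Prop :=
  forall (R : symbol S) (t : (arity R).-tuple A),
    ~~ constant (map part t) -> (t \in interp A R) = g R (map_tuple col t).

End LocalType.

(** A composition theorem in the style of Feferman and Vaught.  A witness of an
element quantifier lies in one part and is invisible in the others; a witness of
a set quantifier can be chosen in each part separately.  Below, A and A' are the
same structure, cut into parts in two ways. *)
Lemma sat_part_type (S : signature) (L : finType) (J : finType) g n k
    (phi : mso S n k) (A A' : structure S) (col : A -> L) (col' : A' -> L)
    (part : A -> J) (part' : A' -> J) v v' V V' :
  local col part g -> local col' part' g ->
  (forall j, part_type col part j phi v V = part_type col' part' j phi v' V') ->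
  sat phi v V = sat phi v' V'.
Proof.
elim: phi A A' col col' part part' v v' V V' => {n k}.
- move=> n k x y A A' col col' part part' v v' V V' _ _ /= eqT.
  (* The hypothesis being symmetric, one implication is enough. *)
  suff half (B B' : structure S) (p : B -> J) (p' : B' -> J) (w : n.-tuple B)
    (w' : n.-tuple B') : (forall j,
     isSome (tnth (restrict [set a | p a == j] w) x) &&
     (tnth (restrict [set a | p a == j] w) x ==
      tnth (restrict [set a | p a == j] w) y) =
     isSome (tnth (restrict [set a | p' a == j] w') x) &&
     (tnth (restrict [set a | p' a == j] w') x ==
      tnth (restrict [set a | p' a == j] w') y)) ->
     tnth w x == tnth w y -> tnth w' x == tnth w' y.
    apply/idP/idP; first by apply: (half _ _ part part'); exact: eqT.
    by apply: (half _ _ part' part) => j; symmetry; exact: eqT.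
  move=> /(_ (p (tnth w x))) + /eqP exy;
    rewrite !tnth_restrict -exy !inE eqxx /=.
  by rewrite eqxx; case: ifP => //= _; case: ifP => //= _ /esym/eqP[->].
- move=> n k R x A A' col col' part part' v v' V V' loc loc' /= eqT.
  (* Each component has the same part and the same colour on both sides. *)
  have eqpc i : part (tnth v (tnth x i)) = part' (tnth v' (tnth x i)) /\
                col (tnth v (tnth x i)) = col' (tnth v' (tnth x i)).
    have [/ffunP/(_ i) + _] := eqT (part (tnth v (tnth x i))).
    rewrite !ffunE !tnth_restrict !inE eqxx /=; case: ifP => //= /eqP-> [->] //.
  have eqp : map part (map_tuple (tnth v) x) =
    map part' (map_tuple (tnth v') x).
    rewrite -!map_comp;
      have -> : tval x = [seq tnth x i | i <- enum 'I_(arity R)].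
      by rewrite map_tnth_enum.
    by rewrite -!map_comp; apply: eq_map => i /=; case: (eqpc i).
  have eqc : map_tuple col (map_tuple (tnth v) x) =
    map_tuple col' (map_tuple (tnth v') x).
    by apply: eq_from_tnth => i; rewrite !tnth_map; case: (eqpc i).
  have [cst|ncst] := boolP (constant (map part (map_tuple (tnth v) x)));
    last first.
    by rewrite loc // loc' -?eqp // eqc.
  pose i0 := Ordinal (arity_gt0 R); pose j := part (tnth v (tnth x i0)).
  have partj i : part (tnth v (tnth x i)) = j.
    move: cst; rewrite /constant; case E: (map _ _) => [|b s] //=.
      by have := congr1 size E; rewrite !size_map size_tuple => s0;
        move: (arity_gt0 R); rewrite [X in 0 < X]s0.
    move=> /allP cst.
    have bs i' : part (tnth v (tnth x i')) = b.
      have : part (tnth v (tnth x i')) \in b :: s.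
        by rewrite -E -map_comp; apply/mapP; exists (tnth x i') => //;
          apply: mem_tnth.
      by rewrite inE => /orP[/eqP //|/cst /= /eqP].
    by rewrite /j !bs.
  have partj' i : part' (tnth v' (tnth x i)) = j by case: (eqpc i) => <-.
  have [_] := eqT j.
  have atom (B : structure S) (p : B -> J) (w : n.-tuple B) :
      (forall i, p (tnth w (tnth x i)) = j) ->
      [exists t in interp B R,
         map_tuple some t == map_tuple (tnth (restrict [set a | p a == j] w)) x]
      = (map_tuple (tnth w) x \in interp B R).
    move=> pj; have eqw :
        map_tuple (tnth (restrict [set a | p a == j] w)) x =
        map_tuple some (map_tuple (tnth w) x).
      by apply: eq_from_tnth => i; rewrite !tnth_map inE pj eqxx.
    rewrite eqw; apply/existsP/idP => [[t /andP[tR /eqP/(congr1 val) /= e]]|tR].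
      suff <- : t = map_tuple (tnth w) x by [].
      by apply: val_inj; apply: (inj_map _ e) => a b [].
    by exists (map_tuple (tnth w) x); rewrite tR /=.
  by rewrite !atom.
- move=> n k x X A A' col col' part part' v v' V V' _ _ /= eqT.
  suff half (B B' : structure S) (p : B -> J) (p' : B' -> J) (w : n.-tuple B)
    (w' : n.-tuple B') (W : k.-tuple {set B}) (W' : k.-tuple {set B'}) :
      (forall j,
     (if tnth (restrict [set a | p a == j] w) x is Some a
      then (a \in [set a | p a == j]) && (a \in tnth W X) else false) =
     (if tnth (restrict [set a | p' a == j] w') x is Some a
      then (a \in [set a | p' a == j]) && (a \in tnth W' X) else false)) ->
     tnth w x \in tnth W X -> tnth w' x \in tnth W' X.
    apply/idP/idP; first by apply: (half _ _ part part'); exact: eqT.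
    by apply: (half _ _ part' part) => j; symmetry; exact: eqT.
  move=> /(_ (p (tnth w x))) + wX;
    rewrite !tnth_restrict !inE eqxx /= inE eqxx wX /=.
  by case: ifP => // _ /esym/andP[].
- by move=> n k phi IH A A' col col' part part' v v' V V' loc loc' eqT;
    rewrite /= (IH _ _ _ _ _ _ _ _ _ _ loc loc' eqT).
- move=> n k phi IH psi IH' A A' col col' part part' v v' V V' loc loc' eqT /=.
  rewrite (IH _ _ _ _ _ _ v v' V V' loc loc'); last by move=> j; case: (eqT j).
  by rewrite (IH' _ _ _ _ _ _ v v' V V' loc loc') // => j; case: (eqT j).
- move=> n k phi IH A A' col col' part part' v v' V V' loc loc' eqT.
  suff half (B B' : structure S) c c' (p : B -> J) (p' : B' -> J) w w' W W' :
      local c p g -> local c' p' g ->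
      (forall j, part_type c p j (MExElt phi) w W =
                part_type c' p' j (MExElt phi) w' W') ->
      sat (MExElt phi) w W -> sat (MExElt phi) w' W'.
    apply/idP/idP; first exact: (half _ _ col col' part part').
    by apply: (half _ _ col' col part' part) => // j; symmetry; exact: eqT.
  move=> lp lp' {}eqT /= /existsP[a sata].
  have aK : a \in [set b | p b == p a] by rewrite inE.
  have /= e1 := congr1 fst (eqT (p a)).
  have := imset_f (fun b => mso_type c [set b | p b == p a] phi
    [tuple of Some b :: restrict [set b | p b == p a] w] W) aK.
  rewrite e1 => /imsetP[a']; rewrite inE => /eqP pa' ea.
  apply/existsP; exists a';
    rewrite -(IH _ _ _ _ _ _ [tuple of a :: w] _ W W' lp lp') //.
  move=> j; rewrite /part_type !restrict_cons !inE pa'; case: eqP => [<- //|_].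
  by case: (eqT j).
- move=> n k phi IH A A' col col' part part' v v' V V' loc loc' eqT.
  suff half (B B' : structure S) c c' (p : B -> J) (p' : B' -> J) w w' W W' :
      local c p g -> local c' p' g ->
      (forall j, part_type c p j (MExSet phi) w W =
                part_type c' p' j (MExSet phi) w' W') ->
      sat (MExSet phi) w W -> sat (MExSet phi) w' W'.
    apply/idP/idP; first exact: (half _ _ col col' part part').
    by apply: (half _ _ col' col part' part) => // j; symmetry; exact: eqT.
  move=> lp lp' {}eqT /= /existsP[X satX].
  have /fin_all_exists[Y eqY] j : exists Y : {set B'},
      part_type c p j phi w [tuple of X :: W] =
      mso_type c' [set a | p' a == j] phi (restrict [set a | p' a == j] w')
        [tuple of Y :: W'].
    have /= e1 := eqT j.
    have := imset_f (fun X => part_type c p j phi w [tuple of X :: W])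
      (isT : X \in {: {set B}}).
    rewrite [imset _ _]e1 => /imsetP[Y _ eY]; exists Y; exact: eY.
  apply/existsP; exists [set b | b \in Y (p' b)].
  rewrite -(IH _ _ _ _ _ _ w _ [tuple of X :: W] _ lp lp') // => j.
  rewrite eqY /part_type; apply: eq_mso_type => i a; rewrite inE => /eqP pa.
  by case: (unliftP ord0 i) => [i'|] ->; rewrite ?tnthS ?tnth0 // inE pa.
Qed.

(** * Few elements are related across parts *)

Lemma constant_map (T : Type) (J J' : eqType) (f : T -> J) (h : J -> J')
    (s : seq T) :
  constant (map f s) -> constant (map (fun x => h (f x)) s).
Proof.
by case: s => //= x s; rewrite !all_map; apply: sub_all => y /= /eqP ->.
Qed.

Lemma local_coarsen (S : signature) (L : finType) (A : structure S)
    (col : A -> L) (J J' : eqType) (part : A -> J) (h : J -> J') g :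
  local col part g -> local col (fun x => h (part x)) g.
Proof. by move=> loc R t ncst; apply: loc; apply: contra ncst;
  apply: constant_map. Qed.

Lemma card_fibres (T U : finType) (f : T -> U) (X : {set T}) n :
  (forall u, #|[set x in X | f x == u]| <= n) -> #|X| <= n * #|U|.
Proof.
move=> le_n; have -> : #|X| = \sum_(u : U) #|[set x in X | f x == u]|.
  rewrite -sum1_card (partition_big f predT) //=; apply: eq_bigr => u _.
  by rewrite -sum1_card; apply: eq_bigl => x; rewrite inE.
by rewrite mulnC -sum_nat_const leq_sum.
Qed.

Section Crossing.
Variables (S : signature) (L : finType) (A : structure S) (col : A -> L).
Variables (J : eqType) (part : A -> J).
Variable g : forall R : symbol S, (arity R).-tuple L -> bool.
Variable phi : mso S 2 0.
Hypothesis part_local : local col part g.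

Let K a := [set b | part b == part a].

(** The type without the point is recorded too: when the point moves from one
part to another, it is the type of the part that is left. *)
Definition pointed_type a : local_type L phi * local_type L phi :=
  (mso_type col (K a) phi [tuple Some a; None] [tuple],
   mso_type col (K a) phi [tuple None; None] [tuple]).

(** By the types, the part of a1 with its point looks like the part of a2 with
its point, and likewise without the points.  So these two parts can be exchanged
while the rest, which contains c, stays in place. *)
Lemma sat_swap a1 a2 c : pointed_type a1 = pointed_type a2 ->
  part c != part a1 -> part c != part a2 ->
  sat phi [tuple a1; c] [tuple] = sat phi [tuple a2; c] [tuple].
Proof.
move=> eqt ca1 ca2.
(* Class 0 is the part of the point, class 1 the other one of the two parts, and
   class 2 the rest; class 1 is empty if the two parts coincide. *)
pose h j : 'I_3 := if j == part a1 then inord 0 else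
           if j == part a2 then inord 1 else inord 2.
pose h' j : 'I_3 := if j == part a2 then inord 0 else
           if j == part a1 then inord 1 else inord 2.
apply: (sat_part_type (col := col) (col' := col) (part := fun x => h (part x))
          (part' := fun x => h' (part x)) (g := g)); try exact: local_coarsen.
have i01 : (inord 0 == inord 1 :> 'I_3) = false by apply/eqP => /(congr1 val);
  rewrite /= !inordK.
have i02 : (inord 0 == inord 2 :> 'I_3) = false by apply/eqP => /(congr1 val);
  rewrite /= !inordK.
have i12 : (inord 1 == inord 2 :> 'I_3) = false by apply/eqP => /(congr1 val);
  rewrite /= !inordK.
have res B (a : A) : restrict B [tuple a; c] =
    [tuple if a \in B then Some a else None; if c \in B then Some c else None].
  exact: val_inj.
have hc : h (part c) = inord 2 by rewrite /h (negPf ca1) (negPf ca2).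
have hc' : h' (part c) = inord 2 by rewrite /h' (negPf ca1) (negPf ca2).
have ha : h (part a1) = inord 0 by rewrite /h eqxx.
have ha' : h' (part a2) = inord 0 by rewrite /h' eqxx.
have [e1 e2] : mso_type col (K a1) phi [tuple Some a1; None] [tuple] =
               mso_type col (K a2) phi [tuple Some a2; None] [tuple] /\
               mso_type col (K a1) phi [tuple None; None] [tuple] =
               mso_type col (K a2) phi [tuple None; None] [tuple].
  by case: eqt.
have i10 := etrans (eq_sym _ _) i01; have i20 := etrans (eq_sym _ _) i02;
  have i21 := etrans (eq_sym _ _) i12.
move=> j; rewrite /part_type !res !inE ha ha' hc hc'.
have : [\/ j = inord 0, j = inord 1 | j = inord 2].
  case: j => -[|[|[|//]]] lt; [constructor 1|constructor 2|constructor 3];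
    by apply: val_inj; rewrite /= inordK.
case=> ->; rewrite ?i01 ?i02 ?i12 ?i21 ?i10 ?i20 ?eqxx.
- have -> : [set a | h (part a) == inord 0] = K a1.
    by apply/setP => a; rewrite !inE /h; case: (part a == _);
      [|case: (part a == _)]; rewrite ?eqxx ?i10 ?i20.
  have -> : [set a | h' (part a) == inord 0] = K a2.
    by apply/setP => a; rewrite !inE /h'; case: (part a == _);
      [|case: (part a == _)]; rewrite ?eqxx ?i10 ?i20.
  exact: e1.
- have [e|ne] := eqVneq (part a1) (part a2).
    have -> // : [set a | h (part a) == inord 1] =
      [set a | h' (part a) == inord 1].
    by apply/setP => a; rewrite !inE /h /h' e.
  have -> : [set a | h (part a) == inord 1] = K a2.
    apply/setP => a; rewrite !inE /h;
      case: (eqVneq (part a) (part a1)) => [->|_].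
      by rewrite i01 (negPf ne).
    by case: (part a == _); rewrite ?eqxx ?i21.
  have -> : [set a | h' (part a) == inord 1] = K a1.
    apply/setP => a; rewrite !inE /h';
      case: (eqVneq (part a) (part a2)) => [->|_].
      by rewrite i01 eq_sym (negPf ne).
    by case: (part a == _); rewrite ?eqxx ?i21.
  by rewrite e2.
- have -> // : [set a | h (part a) == inord 2] =
    [set a | h' (part a) == inord 2].
  by apply/setP => a; rewrite !inE /h /h'; case: (part a == part a1);
    case: (part a == part a2); rewrite ?i02 ?i12.
Qed.

(** Any type is shared by at most two elements of X.  If c is a partner of a and
lies in another part, then by [sat_swap] and uniqueness c lies in the part of
each other element b of the same type.  With three elements a1, a2, a3, the
partner of a1 is in the parts of a2 and a3, and the partner of a2 in those of a1
and a3; so all these parts coincide, and the partner of a1 is in the part of a1,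
a contradiction. *)
Lemma card_crossing (X Y : {set A}) :
  (forall a, a \in X ->
     exists2 c, c \in Y /\ part c != part a & sat phi [tuple a; c] [tuple]) ->
  (forall a b c, a \in X -> b \in X -> c \in Y ->
     sat phi [tuple a; c] [tuple] -> sat phi [tuple b; c] [tuple] -> a = b) ->
  #|X| <= 2 * #|{: local_type L phi * local_type L phi}|.
Proof.
move=> cross functional; apply: (card_fibres (f := pointed_type)) => t.
rewrite leqNgt; apply/negP => /card_gt2P[a1 [a2 [a3 [[]]]]].
rewrite !inE => /andP[X1 /eqP t1] /andP[X2 /eqP t2] /andP[X3 /eqP t3]
  [n12 n23 n31].
have witness a b c : a \in X -> b \in X -> a != b -> pointed_type a =
  pointed_type b ->
    c \in Y -> part c != part a -> sat phi [tuple a; c] [tuple] -> part c =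
      part b.
  move=> Xa Xb nab eqt Yc ca sac; apply/eqP; apply: contraNT nab => cb;
    apply/eqP.
  by apply: (functional _ _ c) => //; rewrite -(sat_swap eqt).
have [c1 [Y1 nc1] s1] := cross _ X1.
have [c2 [Y2 nc2] s2] := cross _ X2.
have e13 : part c1 = part a3 by apply: (witness a1) => //;
  rewrite ?t1 // eq_sym.
have e21 : part c2 = part a1 by apply: (witness a2) => //;
  rewrite ?t1 // eq_sym.
have e23 : part c2 = part a3 by apply: (witness a2) => //; rewrite t2.
by move: nc1; rewrite e13 -e23 e21 eqxx.
Qed.

End Crossing.

(** * Paths in trees *)

(** A name for the component of x in the tree without v: the child of v below
which x lies, or None if x is not below v.  The vertex v is put in a component
of its own, since branch v v = Some v. *)
Definition branch (v x : seq nat) : option (seq nat) :=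
  if prefix v x then Some (take (size v).+1 x) else None.

Lemma prefix_take_size (v x : seq nat) : prefix v x -> take (size v) x = v.
Proof. by rewrite prefixE => /eqP. Qed.

Lemma prefix_anti (v x : seq nat) : prefix v x -> size x <= size v -> v = x.
Proof. by move=> /prefix_take_size {2}<- le; rewrite take_oversize. Qed.

Lemma prefix_rconsE (v x : seq nat) d :
  prefix v (rcons x d) = (v == rcons x d) || prefix v x.
Proof.
apply/idP/orP => [pv|[/eqP->|pv]]; last 2 first.
- exact: prefix_refl.
- exact: prefix_trans pv (prefix_rcons _ _).
have [le|lt] := leqP (size (rcons x d)) (size v).
  by left; rewrite (prefix_anti pv le).
right; rewrite prefixE -{2}(prefix_take_size pv) -cats1 take_cat.
move: lt; rewrite size_rcons ltnS => le; case: ltnP => // ge.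
by have -> : size v = size x; [lia | rewrite subnn take0 cats0 take_size].
Qed.

Lemma edge_inj (u u' v : seq nat) : edge u v -> edge u' v -> u = u'.
Proof. by move=> /edgeP[d ->] /edgeP[d' /rcons_inj[->]]. Qed.

Lemma edge_take (v x : seq nat) : prefix v x -> v != x ->
    edge v (take (size v).+1 x).
Proof.
move=> pv nv; have lt : size v < size x.
  by rewrite ltnNge; apply: contra nv => le; rewrite (prefix_anti pv le).
rewrite /edge size_takel // eqxx andbT prefixE take_takel //
  (prefix_take_size pv).
exact: eqxx.
Qed.

Lemma branch_edge (v a w : seq nat) :
  edge a w -> branch v a != branch v w -> a = v \/ w = v.
Proof.
move=> /edgeP[d ->]; have [-> |na] := eqVneq a v; first by left.
have [-> |nw] := eqVneq (rcons a d) v; first by right.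
rewrite /branch prefix_rconsE [v == _]eq_sym (negPf nw) /=.
case: ifP => [pv|//]; have lt : size v < size a.
  by rewrite ltnNge; apply: contra na => le; rewrite (prefix_anti pv le).
by rewrite -cats1 takel_cat // eqxx.
Qed.

(** Not the distance in the tree, but it also decreases at each step from v
towards x. *)
Definition tree_distance (v x : seq nat) : nat :=
  if prefix v x then size x - size v else size x + size v.

(** That v lies on the path from x to y, both ends included. *)
Definition separates (v x y : seq nat) : bool :=
  (x == v) || (branch v x != branch v y).

Lemma separates_target (x y : seq nat) : separates y x y.
Proof.
rewrite /separates; have [//|ne] := eqVneq x y; rewrite /branch prefix_refl.
case: ifP => //= pyx; rewrite [take _ y]take_oversize //;
  apply: contra ne => /eqP[e].
rewrite eq_sym; apply/eqP/(prefix_anti pyx); rewrite -ltnS ltnNge.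
by apply/negP => /(@size_takel _ _ _); rewrite e; lia.
Qed.

(** The next vertex after v on the way to x is a child of v if x is below v, and
the parent of v otherwise. *)
Lemma separates_step (T : tree_domain) (v x y : seq nat) :
  v \in vertices T -> x \in vertices T -> separates v x y -> v != x ->
  exists v', [/\ v' \in vertices T, edge v v' || edge v' v, separates v' x y &
                 tree_distance v' x < tree_distance v x].
Proof.
move=> vT xT; rewrite {1}/separates eq_sym => /orP[->//|neq] nvx.
have [pvx|npvx] := boolP (prefix v x).
  have lt : size v < size x.
    by rewrite ltnNge; apply: contra nvx => le; rewrite (prefix_anti pvx le).
  have p'x := prefix_take x (size v).+1.
  exists (take (size v).+1 x); split.
  - exact: (prefix_closed p'x).
  - by rewrite edge_take.
  - apply/orP; right; rewrite {1}/branch p'x /branch.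
    case: ifP => // p'y; move: neq; rewrite /branch pvx.
    have pvy : prefix v y.
      by apply: prefix_trans p'y; have /andP[] := edge_take pvx nvx.
    move: p'y; rewrite pvy prefixE size_takel // => /eqP->.
    by rewrite eqxx.
  - rewrite /tree_distance p'x pvx size_takel //; lia.
have pvy : prefix v y.
  by move: neq; rewrite /branch (negPf npvx); case: ifP.
case/lastP: v vT neq nvx npvx pvy => [|v d] vT neq nvx npvx pvy.
  by rewrite prefix0s in npvx.
exists v; split.
- exact: prefix_closed (prefix_rcons v d) vT.
- by apply/orP; right; apply/edgeP; exists d.
- apply/orP; right; rewrite /branch (prefix_trans (prefix_rcons v d) pvy).
  case: ifP => // pvx; apply: contra npvx => /eqP[].
  have -> : take (size v).+1 y = rcons v d.
    by have := prefix_take_size pvy; rewrite size_rcons.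
  by move=> <-; apply: prefix_take.
- rewrite /tree_distance (negPf npvx) size_rcons; case: ifP; lia.
Qed.

(** A union of paths that share the end x is connected. *)
Lemma connected_separates (T : tree_domain) (X : {set T}) (x : seq nat) :
  x \in vertices T ->
  (forall v, v \in X -> exists y, separates (val v) x y /\
     (forall w : T, separates (val w) x y -> w \in X)) ->
  tree_connected X.
Proof.
move=> xT X_sep; pose e : rel T := [rel x y : T | [&& x \in X, y \in X &
      edge (val x) (val y) || edge (val y) (val x)]].
have e_sym : connect_sym e.
  apply: sym_connect_sym => u w; rewrite /e /= andbCA.
  by congr [&& _, _ & _]; rewrite orbC.
have to_x (v : T) : v \in X -> connect e v [` xT]%fset.
  move: {2}(tree_distance _ _).+1 (ltnSn (tree_distance (val v) x)) => m.
  elim: m v => // m IH v lt_m vX.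
  have [/eqP vx|nvx] := boolP (val v == x).
    by have -> : v = [` xT]%fset by apply: val_inj.
  have [y [sep sepX]] := X_sep _ vX.
  have [v' [v'T adj sep' lt]] := separates_step (valP v) xT sep nvx.
  have v'X := sepX [` v'T]%fset sep'.
  apply: (connect_trans (y := [` v'T]%fset)); last first.
    exact: (IH [` v'T]%fset (leq_trans lt lt_m) v'X).
  by apply: connect1; rewrite /e /= vX v'X adj.
move=> v w vX wX; apply: (connect_trans (to_x v vX)).
by rewrite -/e e_sym; apply: to_x.
Qed.

(** * Incidence structures of trees after expansion and copying *)

(** An arrangement of the elements of M along the tree T, at most b at each
vertex, such that at each v the branches interact only through the colours.
The data L, g and b are shared by all trees, while the colouring may depend on
v. *)
Definition layout (T : tree_domain) (S : signature) (M : structure S)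
    (L : finType) (g : forall R : symbol S, (arity R).-tuple L -> bool)
    (b : nat) (pos : M -> seq nat) : Prop :=
  [/\ forall x, pos x \in vertices T,
      forall v, v \in vertices T -> #|[set x | pos x == v]| <= b &
      forall v, v \in vertices T ->
        exists col : M -> L, local col (fun x => branch v (pos x)) g].

Lemma constant_tuple1 (J : eqType) (t : 1.-tuple J) : constant t.
Proof. by case/tupleP: t => a t; rewrite tuple0. Qed.

Section IncidenceLayout.
Variable T : tree_domain.
Let N := incidence (successor_tree T).

(** An edge is placed at its lower end. *)
Definition tree_position (z : N) : seq nat :=
  match z with
  | inl u => val u
  | inr c => last [::] [seq val x | x <- val (val c)]
  end.

Lemma tree_tupleP (c : tuples (successor_tree T)) :
  exists u w : T, edge (val u) (val w) /\ val (val c) = [:: u; w].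
Proof.
case: c => c /= /existsP[R /existsP[t /andP[]]].
rewrite inE; case/tupleP: t => u t; case/tupleP: t => w t; rewrite tuple0 /=.
by rewrite !(tnth_nth u) /= => euw /eqP <-; exists u, w.
Qed.

Definition tree_colour_type : finType := (bool * bool * bool * bool)%type.

(** Whether z is v, the parent of v, an edge leaving v downwards, or the edge
above v.  Incidences between different branches at v concern only these. *)
Definition tree_colour (v : seq nat) (z : N) : tree_colour_type :=
  match z with
  | inl u => (val u == v, edge (val u) v, false, false)
  | inr c => (false, false, head [::] [seq val x | x <- val (val c)] == v,
              last [::] [seq val x | x <- val (val c)] == v)
  end.

Definition tree_cross (s : symbol (incidence_sig graph_sig)) :
    (arity s).-tuple tree_colour_type -> bool :=
  match s return (incidence_arity s).-tuple tree_colour_type -> bool with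
  | inl R => fun=> false
  | inr i => fun t =>
     let: (a1, a2, _, _) := tnth t ord0 in
     let: (_, _, b1, b2) := tnth t ord_max in
     (i == 0 :> nat) && (a1 && b1 || a2 && b2)
  end.

(** The lower end of an edge is placed with the edge, so only the upper end can
be in another branch.  By [branch_edge] this happens only if v is an end of the
edge. *)
Lemma incidence_layout : layout T (M := N) tree_cross 2 tree_position.
Proof.
split.
- case=> [u|c] /=; first exact: valP.
  by have [u [w [_ ->]]] := tree_tupleP c; exact: (valP w).
- move=> v vT; pose f (z : N) := if z is inl _ then true else false.
  rewrite -(card_in_imset (f := f)); first by rewrite -card_bool max_card.
  move=> [u|c] [u'|c'] //; rewrite !inE /=.
    by move=> /eqP eu /eqP eu' _; congr inl; apply: val_inj;
      exact: etrans eu (esym eu').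
  have [u [w [e ec]]] := tree_tupleP c;
    have [u' [w' [e' ec']]] := tree_tupleP c'.
  rewrite ec ec' /= => /eqP ew /eqP ew' _; congr inr; apply/val_inj/val_inj.
  rewrite ec ec'; have eww : w = w' by apply: val_inj;
    exact: etrans ew (esym ew').
  by rewrite eww; congr [:: _; _]; apply: val_inj; apply: edge_inj e _;
    rewrite eww.
- move=> v vT; exists (tree_colour v) => -[R|i] t;
    first by rewrite constant_tuple1.
  rewrite inE /tree_cross !tnth_map.
  case/tupleP: t => x t; case/tupleP: t => y t; rewrite tuple0 {t}.
  rewrite !(tnth_nth x) /= andbT.
  case: x => [a|c]; case: y => [a'|c'] //=; rewrite ?andbF //.
  have [u [w [e ->]]] := tree_tupleP c'; rewrite /= => neq.
  case: i => -[|[|i]] lti //=; last by rewrite onth0n.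
    2: by apply/eqP => -[ewa]; rewrite ewa eqxx in neq.
  apply/eqP/orP => [[ua]|].
    case: ua neq => <-; rewrite eq_sym => neq.
    case: (branch_edge e neq) => ev; [left|right]; first by rewrite andbb;
      apply/eqP.
    by apply/andP; split; [rewrite -[v]ev | apply/eqP].
  case=> /andP[].
    by move=> /eqP ea /eqP eu; congr Some; apply: val_inj;
      exact: etrans eu (esym ea).
  by move=> ea /eqP ew; congr Some; apply: val_inj; apply: edge_inj e _;
    rewrite [X in edge _ X]ew.
Qed.
End IncidenceLayout.

Lemma layout_iso (T : tree_domain) (S : signature) (M N : structure S)
    L g b pos :
  iso M N -> layout T (M := M) (L := L) g b pos ->
  exists pos', layout T (M := N) (L := L) g b pos'.
Proof.
move=> [f [h fK hK] fR] [posT pos_b pos_loc]; exists (pos \o h); split => //=.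
- by move=> v vT; apply: leq_trans (pos_b v vT);
  rewrite -(card_imset _ (can_inj hK)) subset_leq_card //;
    apply/fintype.subsetP => _ /imsetP[x + ->]; rewrite !inE.
- move=> v vT; have [col loc] := pos_loc v vT; exists (col \o h) => R t ncst.
  have -> : t = map_tuple f (map_tuple h t).
    by apply: eq_from_tnth => i; rewrite !tnth_map hK.
  rewrite fR loc -?map_comp //; congr g.
  by apply: eq_from_tnth => i; rewrite !tnth_map /= fK.
Qed.

Definition expand_cross (S : signature) m (L : finType)
    (g : forall R : symbol S, (arity R).-tuple L -> bool)
      (s : symbol (exp_sig S m)) :
    (arity s).-tuple L -> bool :=
  match s return (exp_arity s).-tuple L -> bool with
  | inl R => @g R
  | inr i => fun=> false
  end.

Lemma expand_layout (T : tree_domain) (S : signature) (M : structure S)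
    L g b pos
    m (P : 'I_m -> {set M}) :
  layout T (M := M) (L := L) g b pos ->
  layout T (M := Defs.expand P) (expand_cross (m := m) g) b pos.
Proof.
move=> [posT pos_b pos_loc]; split => // v vT; have [col loc] := pos_loc v vT.
by exists col => -[R|i] t ncst; [exact: loc | rewrite constant_tuple1 in ncst].
Qed.

Definition copy_cross (S : signature) k (L : finType)
    (g : forall R : symbol S, (arity R).-tuple L -> bool)
    (s : symbol (labelled_copy_sig S k)) :
    (arity s).-tuple (L * 'I_k)%type -> bool :=
  match s return (labelled_copy_arity s).-tuple (L * 'I_k)%type -> bool with
  | inl R => fun t => g R (map_tuple fst t) && constant (map snd t)
  | inr _ => fun=> false
  end.

Lemma labelled_copy_layout (T : tree_domain) (S : signature) (M : structure S)
    L g b pos k :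
  layout T (M := M) (L := L) g b pos ->
  layout T (M := labelled_copy k M) (copy_cross (k := k) g) (b * k)
    (fun x => pos x.1).
Proof.
move=> [posT pos_b pos_loc]; split => // v vT.
  have -> : [set x : M * 'I_k | pos x.1 == v] =
    finset.setX [set x | pos x == v] finset.setT.
    by apply/setP => x; rewrite !inE andbT.
  by rewrite cardsX cardsT card_ord leq_mul // pos_b.
have [col loc] := pos_loc v vT;
  exists (fun x => (col x.1, x.2)) => -[R|[i|]] t ncst.
- rewrite inE loc /=; last by rewrite -map_comp.
  rewrite -map_comp; congr (g _ _ && _).
  by apply: eq_from_tnth => i; rewrite !tnth_map.
- by rewrite constant_tuple1 in ncst.
rewrite inE /=; apply/negbTE; apply: contra ncst.
case/tupleP: t => x t; case/tupleP: t => y t; rewrite tuple0 {t}.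
by rewrite !(tnth_nth x) /= => /eqP ->; rewrite eqxx.
Qed.

Lemma tree_layouts m k : exists (L : finType) g b, forall T N,
  iso (incidence (successor_tree T)) N ->
  forall P : 'I_m -> {set N},
  exists pos, layout T (M := copy k (Defs.expand P)) (L := L) g b pos.
Proof.
have [k1|k2] := leqP k 1.
  exists tree_colour_type.
  case: k k1 => [|[|//]] _;
    exists (expand_cross (m := m) tree_cross), 2 => T N isoN P;
    have [pos lay] := layout_iso isoN (incidence_layout T); exists pos;
      exact: expand_layout.
case: k k2 => [|[|k]] // _.
exists (tree_colour_type * 'I_k.+2)%type,
  (copy_cross (k := k.+2) (expand_cross (m := m) tree_cross)), (2 * k.+2).
move=> T N isoN P; have [pos lay] := layout_iso isoN (incidence_layout T).
by exists (fun x => pos x.1); apply/labelled_copy_layout/expand_layout.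
Qed.

(** * Tree decompositions from transductions *)

Section Decomposition.
Variables (S0 S : signature) (T : tree_domain) (N : structure S0)
    (A : structure S).
Variables (L : finType) (g : forall R : symbol S0, (arity R).-tuple L -> bool).
Variables (b : nat) (pos : N -> seq nat).
Hypothesis N_layout : layout T g b pos.
Variable h : incidence A -> N.
Hypothesis h_inj : injective h.
Variable phi : 'I_(max_arity S) -> mso S0 2 0.
Hypothesis sat_phi : forall j a c,
  sat (phi j) [tuple h (inl a); h (inr c)] [tuple] = (onth (val c) j == Some a).

(** The element a is in the bags along the paths from its own vertex to those of
the tuples containing it. *)
Definition path_bag (v : T) : {set A} :=
  [set a | (pos (h (inl a)) == val v) ||
    [exists c : tuples A, (a \in (val (val c) : seq A)) &&
       separates (val v) (pos (h (inl a))) (pos (h (inr c)))]].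

Lemma seq_inP (R : symbol S) (t : (arity R).-tuple A) :
  t \in interp A R -> exists c : tuples A, val (val c) = t.
Proof.
move=> tR; have le : size t <= max_arity S.
  by rewrite size_tuple (leq_bigmax (F := fun R : symbol S => arity R)).
have tA : [exists R, seq_in (A := A) R (Bseq le)].
  by apply/existsP; exists R; apply/existsP; exists t; rewrite tR /=.
by exists (exist _ (Bseq le) tA).
Qed.

(** The bag of v contains the elements placed at v and, for each j, those that
are the j-th component of a tuple in another branch at v; the latter are counted
by [card_crossing]. *)
Lemma path_bag_decomposition : exists D : tree_decomposition A,
  underlying D = T /\
  forall v : underlying D, #|bag v| <=
   b + \sum_j 2 * #|{: local_type L (phi j) * local_type L (phi j)}|.
Proof.
have [posT pos_b pos_loc] := N_layout.
have cover a : exists v, a \in path_bag v.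
  exists [` posT (h (inl a))]%fset; by rewrite inE; apply/orP; left.
have conn a : tree_connected [set v | a \in path_bag v].
  apply: (connected_separates (posT (h (inl a)))) => v; rewrite !inE.
  case/orP => [/eqP e|/existsP[c /andP[ac sep]]].
    exists (pos (h (inl a))); split; first by apply/orP; left; apply/eqP.
    by move=> w; rewrite !inE /separates eqxx orbF => ->.
  exists (pos (h (inr c))); split=> // w sepw; rewrite !inE; apply/orP; right.
  by apply/existsP; exists c; rewrite ac.
have tup (R : symbol S) (t : (arity R).-tuple A) : t \in interp A R ->
    exists v, {subset t <= path_bag v}.
  move=> /seq_inP[c ct]; exists [` posT (h (inr c))]%fset => a at_.
  by rewrite inE; apply/orP; right; apply/existsP; exists c;
    rewrite ct at_ separates_target.
exists (TreeDecomposition cover conn tup); split=> // v /=.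
have vT := valP v; have [col loc] := pos_loc _ vT.
pose X j : {set A} :=
  [set a | [exists c : tuples A, (onth (val c) j == Some a) &&
   (branch (val v) (pos (h (inl a))) != branch (val v) (pos (h (inr c))))]].
have sub : path_bag v \subset
    [set a | pos (h (inl a)) == val v] :|: \bigcup_(j : 'I_(max_arity S)) X j.
  apply/fintype.subsetP => a;
    rewrite !inE => /orP[->//|/existsP[c /andP[ac /orP[->//|ne]]]].
  apply/orP; right; have /onthP[j ej] := ac.
  have ltj : j < max_arity S.
    by apply: leq_trans (valP (val c)); rewrite -onthTE ej.
  apply/bigcupP; exists (Ordinal ltj) => //; rewrite inE; apply/existsP;
    exists c.
  by rewrite ej eqxx.
apply: leq_trans (subset_leq_card sub) _.
apply: leq_trans (leq_card_setU _ _) _; apply: leq_add.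
  apply: leq_trans (pos_b _ vT);
    rewrite -(card_imset (f := fun a => h (inl a)));
      last by move=> x y /h_inj[].
  by apply: subset_leq_card; apply/fintype.subsetP => _ /imsetP[a + ->];
    rewrite !inE.
have card_bigcup (s : seq 'I_(max_arity S)) : #|\bigcup_(j <- s) X j| <=
  \sum_(j <- s) #|X j|.
  elim: s => [|j s IH]; first by rewrite !big_nil cards0.
  by rewrite !big_cons (leq_trans (leq_card_setU _ _)) // leq_add2l.
apply: leq_trans (card_bigcup _) _; apply: leq_sum => j _.
rewrite -(card_imset (f := fun a => h (inl a))); last by move=> x y /h_inj[].
apply: (card_crossing loc (Y := [set h (inr c) | c : tuples A])).
  move=> _ /imsetP[a + ->]; rewrite inE => /existsP[c /andP[cj ne]].
  exists (h (inr c)); first by rewrite imset_f // eq_sym.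
  by rewrite sat_phi.
move=> _ _ _ /imsetP[a _ ->] /imsetP[a' _ ->] /imsetP[c _ ->].
by rewrite !sat_phi => /eqP-> /eqP[->].
Qed.
End Decomposition.

Lemma iso_refl (S : signature) (A : structure S) : iso A A.
Proof.
exists id; first by exists id.
by move=> R t; have -> : map_tuple id t = t by apply: val_inj;
  rewrite /= map_id.
Qed.

Lemma iso_sym (S : signature) (A B : structure S) : iso A B -> iso B A.
Proof.
move=> [f [h fK hK] fR]; exists h; first by exists f.
move=> R t; rewrite -fR; have -> // : map_tuple f (map_tuple h t) = t.
by apply: eq_from_tnth => i; rewrite !tnth_map hK.
Qed.

Lemma iso_trans (S : signature) (A B C : structure S) : iso A B -> iso B C ->
    iso A C.
Proof.
move=> [f bf fR] [h bh hR]; exists (h \o f); first exact: bij_comp.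
move=> R t; rewrite -fR -hR.
have -> // : map_tuple (h \o f) t = map_tuple h (map_tuple f t).
by apply: eq_from_tnth => i; rewrite !tnth_map.
Qed.

(** The underlying tree is the one that the transduction starts from, so any
property of the trees in K is inherited by the decompositions. *)
Lemma decompositions_of_transduction (S : signature) (C : class S)
    (K : class graph_sig) (Q : tree_domain -> Prop) :
  (forall G, K G -> exists2 T, Q T & G = successor_tree T) ->
  incidence_transducible C K ->
  exists n, forall A, C A -> exists D : tree_decomposition A,
    Q (underlying D) /\
    forall v : underlying D, #|bag v| <= n.
Proof.
move=> K_tree [t t_C].
have [L [g [b lay]]] := tree_layouts (tr_exp t) (tr_copy t).
pose phi (j : 'I_(max_arity S)) :
  mso (copy_sig (exp_sig (incidence_sig graph_sig) (tr_exp t)) (tr_copy t)) 2 0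
   := bt_phi (tr_basic t) (inr j : symbol (incidence_sig S)).
exists (b + \sum_j 2 * #|{: local_type L (phi j) * local_type L (phi j)}|) =>
  A CA.
have [N [G KG isoN] [P [_ isoA]]] : transduce_class t (incidence_class K)
  (incidence A).
  by apply: t_C; exists A => //; apply: iso_refl.
have [T QT eG] := K_tree G KG; rewrite eG in isoN KG.
have [pos posL] := lay T N isoN P.
have [f bf fR] := iso_sym isoA.
have [D [eD bagD]] : exists D : tree_decomposition A, underlying D = T /\
  forall v : underlying D, #|bag v| <=
   b + \sum_j 2 * #|{: local_type L (phi j) * local_type L (phi j)}|.
  have h_inj : injective (fun x => val (f x)).
    by move=> x y /val_inj; apply: bij_inj.
  apply: (path_bag_decomposition posL h_inj (phi := phi)).
  move=> j a c.
  have := fR (inr j) [tuple inl a; inr c].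
  rewrite !inE /= => <-; congr (sat _ _ _); first exact: val_inj.
by exists D; split; [rewrite eD|].
Qed.

(** * Bounded width *)

Lemma width_le (S : signature) (A : structure S) (D : tree_decomposition A) n :
  (width D <= n%:Z)%R <-> forall v : underlying D, #|bag v| <= n.+1.
Proof.
split=> [le_n v|le_n].
  have : (#|bag v|%:Z - 1 <= width D)%R.
    exact: (le_bigmax (-1)%R (fun v : underlying D => (#|bag v|%:Z - 1)%R)).
  lia.
by apply/bigmax_leP; split=> [|v _]; [lia | have := le_n v; lia].
Qed.

Lemma width_ge (S : signature) (A : structure S) (D : tree_decomposition A) :
    (-1 <= width D)%R.
Proof. exact: bigmax_ge_id. Qed.

(** Widths are integers bounded below, so that the infimum is a minimum. *)
Lemma min_width_le (Q : tree_domain -> Prop) (S : signature) (A : structure S)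
    n :
  (min_width Q A <= n%:Z%:E)%E <->
  exists D : tree_decomposition A, Q (underlying D) /\
    forall v : underlying D, #|bag v| <= n.+1.
Proof.
rewrite /min_width /infimum; set W := (X in X == _).
have least : (W !=set0)%classic -> exists2 D : tree_decomposition A,
  Q (underlying D) &
    xget +oo%E (infimums W) = (width D)%:E%E.
  move=> [_ [D QD _]].
  pose P m := `[< exists2 D : tree_decomposition A, Q (underlying D) & width D =
    (m%:Z - 1)%R >].
  have exP : exists m, P m.
    exists `|(width D + 1)%R|%N; apply/asboolP; exists D => //.
    by have := width_ge D; lia.
  case: (ex_minnP exP) => m0 /asboolP[D0 QD0 eD0] minP.
  exists D0 => //; suff inf : infimums W (width D0)%:E%E.
    by apply: xget_unique => // w infw; apply: is_subset1_infimums infw inf.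
  split=> [_ [D1 QD1 ->]|w lw]; last by apply: lw; exists D0.
  rewrite lee_fin eD0; have := minP `|(width D1 + 1)%R|%N.
  have := width_ge D1 => ge1 /(_ _) min1.
  have : P `|(width D1 + 1)%R|%N by apply/asboolP; exists D1 => //; lia.
  by move/min1; lia.
split.
  case: eqP => [_ //|/eqP/set0P/least[D QD ->]];
    rewrite lee_fin => /width_le le_n.
  by exists D.
move=> [D [QD le_n]].
have neW : (W !=set0)%classic by exists (width D)%:E%E; exists D.
have /negPf -> : W != classical_sets.set0 by apply/set0P.
rewrite /= in least.
suff : (xget +oo%E (infimums W) <= (width D)%:E)%E.
  by move=> /le_trans; apply; rewrite lee_fin; apply/width_le.
have [D0 QD0 e0] := least neW.
case: xgetP e0 => [w -> [lbw _] _|_ //]; by apply: lbw; exists D.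
Qed.

(** An unbounded set of widths has the supremum +oo; conversely any bound on the
widths also bounds the supremum. *)
Lemma class_width_lt (Q : tree_domain -> Prop) (S : signature) (C : class S) :
  (class_width (@min_width Q S) C < +oo)%E <->
  exists n, forall A, C A -> exists D : tree_decomposition A,
    Q (underlying D) /\ forall v : underlying D, #|bag v| <= n.
Proof.
rewrite /class_width /supremum; set W := (X in X == _); split.
  case: eqP => [W0 _|/eqP/set0P neW lt].
    exists 0 => A CA; exfalso.
    by have : W (min_width Q A) by [exists A]; rewrite W0.
  apply: contrapT => unbounded;
    suff sup : xget -oo%E (supremums W) = +oo%E by rewrite sup ltxx in lt.
  suff sup : supremums W +oo%E.
    by apply: xget_unique => // w supw; apply: is_subset1_supremums supw sup.
  split=> [w _|w ubw]; first exact: leey.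
  rewrite leNgt; apply/negP => ltw; apply: unbounded.
  suff [n le_n] : exists n : nat, (w <= n%:Z%:E)%E.
    exists n.+1 => A CA; apply/min_width_le; apply: le_trans le_n.
    by apply: ubw; exists A.
  case: w ltw {ubw} => [z _|//|_]; last by exists 0; rewrite leNye.
  by exists `|z|%N; rewrite lee_fin; lia.
move=> [n le_n]; case: ifP => _; first by [].
case: xgetP => [w -> [_ lub]|_]; last by [].
apply: (@le_lt_trans _ _ n%:Z%:E%E); last exact: ltry.
apply: lub => _ [A CA ->]; apply/min_width_le.
by have [D [QD le]] := le_n A CA; exists D; split=> // v; apply: leqW.
Qed.

(** * Topmost vertices and colourings *)

Section Colouring.
Variables (S : signature) (A : structure S) (D : tree_decomposition A).
Notation T := (underlying D).

Lemma prefix_comparable (u w v : seq nat) :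
  prefix u v -> prefix w v -> size u <= size w -> prefix u w.
Proof.
move=> /prefix_take_size pu /prefix_take_size pw le.
by rewrite prefixE -pw take_takel // pu.
Qed.

(** Along a path inside the connected set of vertices whose bag contains a, the
walk can never leave the subtree of a vertex t of minimal depth: the only way
out leads to the parent of t.  It also visits all vertices between t and its
current position. *)
Lemma top_exists (a : A) : exists t : T, a \in bag t /\
  forall v : T, a \in bag v -> prefix (val t) (val v) /\
    forall w : T, prefix (val t) (val w) -> prefix (val w) (val v) ->
      a \in bag w.
Proof.
have [v0 av0] := bag_cover D a.
case: (arg_minnP (fun v : T => size (val v)) (P := fun v => a \in bag v) av0) =>
  t at_ t_min.
exists t; split=> // v av.
have := @bag_connected _ _ D a t v; rewrite !inE => /(_ at_ av).
move=> /connectP[p]; elim/last_ind: p v av => [|p u IH] v av /=.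
  move=> _ ->; split; first exact: prefix_refl.
  move=> w tw wt; suff -> : w = t by [].
  by apply: val_inj; apply: prefix_anti wt (size_prefix tw).
rewrite rcons_path last_rcons => /andP[pth /=];
  rewrite !inE => /and3P[al au adj] vu.
rewrite {v av}vu; have [tl below] := IH _ al pth erefl.
set l := last t p in al adj tl below.
case/orP: adj => /edgeP[d e].
  rewrite e; split; first by rewrite prefix_rconsE tl orbT.
  move=> w tw; rewrite prefix_rconsE -e => /orP[/eqP ew|wl]; last exact: below.
  by have -> : w = u by apply: val_inj.
have ul : prefix (val u) (val l) by have := prefix_rcons (val u) d; rewrite -e.
split; first by apply: prefix_comparable tl ul _; exact: t_min.
by move=> w tw wu; apply: below => //; apply: prefix_trans wu ul.
Qed.

(** Colour the elements by increasing depth of their topmost vertices.  The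
elements coloured before a that share a bag with a all lie in the bag of top a,
so at most n colours are excluded. *)
Lemma colouring_exists n (top : A -> T) :
  (forall v : T, #|bag v| <= n.+1) ->
  (forall a, a \in bag (top a)) ->
  (forall a (v : T), a \in bag v -> prefix (val (top a)) (val v) /\
    forall w : T, prefix (val (top a)) (val w) -> prefix (val w) (val v) ->
      a \in bag w) ->
  exists col : A -> 'I_n.+1, forall v : T, {in bag v &, injective col}.
Proof.
move=> le_n top_bag topP.
suff [col colP] : exists col : A -> 'I_n.+1, forall v : T,
  {in bag v :&: [set: A] &, injective col}.
  by exists col => v; have := colP v; rewrite finset.setIT.
move: [set: A]%SET => X; move: {2}#|X|.+1 (ltnSn #|X|) => m.
elim: m X => // m IH X ltX.
have [->|[a0 a0X]] := set_0Vmem X.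
  by exists (fun=> ord0) => v x y; rewrite finset.setI0 inE.
case: (arg_maxnP (fun a => size (val (top a))) a0X) => a aX a_max.
have [|col colP] := IH (X :\ a).
  by move: ltX; rewrite (cardsD1 a X) [a \in X]aX.
pose B := bag (top a) :\ a.
have [c cB] : exists c, c \notin col @: B.
  apply/existsP; rewrite -negb_forall; apply/negP => /forallP all_c.
  have : n.+1 <= #|B|.
    rewrite -{1}(card_ord n.+1) (leq_trans _ (leq_imset_card col B)) //.
    by apply: subset_leq_card; apply/fintype.subsetP => c _; exact: all_c.
  by have := le_n (top a); rewrite (cardsD1 a) top_bag -/B; lia.
have fresh (v : T) b : a \in bag v -> b \in bag v -> b \in X -> b != a ->
  col b != c.
  move=> av bv bX ba; apply: contra cB => /eqP <-; apply: imset_f;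
    rewrite !inE ba /=.
  have [pa _] := topP a v av; have [pb belowb] := topP b v bv.
  by apply: belowb => //; apply: prefix_comparable pb pa _; exact: a_max.
exists (fun b => if b == a then c else col b) => v x y.
rewrite !inE => /andP[xv xX] /andP[yv yX].
have [ex|xa] := eqVneq x a; have [ey|ya] := eqVneq y a; rewrite ?ex ?ey //.
- by move=> e; rewrite ex in xv; have := fresh v y xv yv yX ya; rewrite -e eqxx.
- by move=> e; rewrite ey in yv; have := fresh v x yv xv xX xa; rewrite e eqxx.
by apply: (colP v); rewrite !inE ?xa ?ya ?xv ?yv.
Qed.
End Colouring.

(** * Formulae *)

Section Formulas.
Variable S : signature.

Definition mso_true n k : mso S n k := MNot (MExElt (MNot (MEq S k ord0 ord0))).
Definition mso_any n k (s : seq (mso S n k)) : mso S n k :=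
  foldr (fun phi psi => MNot (MAnd (MNot phi) (MNot psi)))
    (MNot (mso_true n k)) s.

Lemma sat_not (A : structure S) n k (phi : mso S n k) (v : n.-tuple A)
    (V : k.-tuple {set A}) :
  sat (MNot phi) v V = ~~ sat phi v V.
Proof. by []. Qed.

Lemma sat_and (A : structure S) n k (phi psi : mso S n k) (v : n.-tuple A)
    (V : k.-tuple {set A}) :
  sat (MAnd phi psi) v V = sat phi v V && sat psi v V.
Proof. by []. Qed.

Lemma sat_mem (A : structure S) n k (x : 'I_n) (X : 'I_k) (v : n.-tuple A)
    (V : k.-tuple {set A}) :
  sat (MMem S x X) v V = (tnth v x \in tnth V X).
Proof. by []. Qed.

Lemma sat_exelt (A : structure S) n k (phi : mso S n.+1 k) (v : n.-tuple A)
    (V : k.-tuple {set A}) :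
  sat (MExElt phi) v V = [exists a, sat phi [tuple of a :: v] V].
Proof. by []. Qed.

Lemma sat_exset (A : structure S) n k (phi : mso S n k.+1) (v : n.-tuple A)
    (V : k.-tuple {set A}) :
  sat (MExSet phi) v V = [exists X, sat phi v [tuple of X :: V]].
Proof. by []. Qed.

Lemma sat_true (A : structure S) n k (v : n.-tuple A) (V : k.-tuple {set A}) :
  sat (mso_true n k) v V.
Proof. by rewrite /=; apply/existsP => -[a]; rewrite eqxx. Qed.

Lemma sat_any (A : structure S) n k (s : seq (mso S n k)) (v : n.-tuple A)
    (V : k.-tuple {set A}) :
  sat (mso_any s) v V = has (fun phi => sat phi v V) s.
Proof.
elim: s => [|phi s IH]; first exact: (congr1 negb (sat_true v V)).
by rewrite /= IH negb_and !negbK.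
Qed.

Definition mso_some (I : finType) (P : pred I) n k (F : I -> mso S n k) :
    mso S n k :=
  mso_any [seq F i | i <- enum P].

Lemma sat_some (A : structure S) (I : finType) (P : pred I)
    n k (F : I -> mso S n k)
    (v : n.-tuple A) (V : k.-tuple {set A}) :
  sat (mso_some P F) v V = [exists i, P i && sat (F i) v V].
Proof.
rewrite sat_any has_map; apply/hasP/existsP => [[i]|[i /andP[Pi sati]]].
  by rewrite mem_enum => Pi sati; exists i; apply/andP.
by exists i; rewrite // mem_enum.
Qed.
End Formulas.

(** * The decoding transduction *)

Notation var n i := (@Ordinal n i isT) (only parsing).

Lemma max_arity_graph i : i < 2 -> i < max_arity graph_sig.
Proof. by move=> lt;
  apply: leq_trans lt
    (leq_bigmax (F := fun R : symbol graph_sig => arity R) tt). Qed.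

Definition endpoint i (lt : i < 2) : 'I_(max_arity graph_sig) :=
    Ordinal (max_arity_graph lt).

Section Transduction.
Variables (S : signature) (K : nat).

(** The copies of the tree: one for the elements of each colour, and one for the
tuples with each word of colours. *)
Definition slot : finType := ('I_K + (max_arity S).-bseq 'I_K)%type.
(** A label [inl i] marks the vertices that code something in copy i, and a
label [inr (R, i)] those that code in copy i a tuple belonging to R. *)
Definition label : finType := (slot + symbol S * slot)%type.
(** Two spare copies ensure that copying adds the predicates that name the
copies. *)
Definition source_sig : signature :=
  labelled_copy_sig (exp_sig (incidence_sig graph_sig) #|label|) #|slot|.+2.
Definition copy_of (i : slot) : 'I_#|slot|.+2 :=
    lift ord0 (lift ord0 (enum_rank i)).

Lemma copy_of_inj : injective copy_of.
Proof. by move=> i j /lift_inj/lift_inj/enum_rank_inj. Qed.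

Definition in_copy n k (i : slot) (x : 'I_n) : mso source_sig n k :=
  @MRel source_sig n k (inr (Some (copy_of i))) [tuple x].
Definition has_label n k (l : label) (x : 'I_n) : mso source_sig n k :=
  @MRel source_sig n k (inl (inr (enum_rank l))) [tuple x].
Definition is_end n k i (lt : i < 2) (x e : 'I_n) : mso source_sig n k :=
  @MRel source_sig n k (inl (inl (inr (endpoint lt)))) [tuple x; e].
Definition same_origin n k (x y : 'I_n) : mso source_sig n k :=
  @MRel source_sig n k (inr None) [tuple x; y].

Definition not_closed_origin : mso source_sig 2 1 :=
  MExElt (MExElt (MAnd
    (MAnd (MMem source_sig (var 4 0) (var 1 0))
      (same_origin _ (var 4 1) (var 4 0)))
    (MNot (MMem source_sig (var 4 1) (var 1 0))))).

Definition not_closed_parent (i : slot) : mso source_sig 2 1 :=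
  MExElt (MExElt (MExElt (MAnd
    (MAnd (MMem source_sig (var 5 1) (var 1 0))
      (MNot (has_label _ (inl i) (var 5 1))))
    (MAnd (MAnd (is_end _ (isT : 0 < 2) (var 5 2) (var 5 0))
                (is_end _ (isT : 1 < 2) (var 5 1) (var 5 0)))
          (MNot (MMem source_sig (var 5 2) (var 1 0))))))).

(** That x (variable 0) belongs to each set X which contains y (variable 1), is
closed under changing the copy, and contains with each vertex not labelled i
also its parent.  So x is reached from y by climbing until the first label i. *)
Definition reaches (i : slot) : mso source_sig 2 0 :=
  MNot (MExSet (MAnd
    (MAnd (MMem source_sig (var 2 1) (var 1 0))
      (MNot (MMem source_sig (var 2 0) (var 1 0))))
    (MAnd (MNot not_closed_origin) (MNot (not_closed_parent i))))).

Definition target_interp (s : symbol (incidence_sig S)) :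
    mso source_sig (arity s) 0 :=
  match s return mso source_sig (incidence_arity s) 0 with
  | inl R => mso_some predT (fun i : slot =>
      MAnd (in_copy 0 i (var 1 0)) (has_label 0 (inr (R, i)) (var 1 0)))
  | inr j => mso_some
      (fun iw : 'I_K * (max_arity S).-bseq 'I_K => onth iw.2 j == Some iw.1)
      (fun iw => MAnd (MAnd (in_copy 0 (inl iw.1) (var 2 0))
        (in_copy 0 (inr iw.2) (var 2 1)))
                      (reaches (inl iw.1)))
  end.

Definition decoding : transduction (incidence_sig graph_sig)
    (incidence_sig S) :=
  @Transduction (incidence_sig graph_sig)
    (incidence_sig S) #|label| #|slot|.+2 isT
    (@BasicTransduction source_sig (incidence_sig S) (mso_true source_sig 0 0)
      (mso_some predT (fun i : slot => MAnd (in_copy 0 i (var 1 0))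
        (has_label 0 (inl i) (var 1 0))))
      target_interp).

Section Semantics.
Variable N : structure (incidence_sig graph_sig).
Variable P : 'I_#|label| -> {set N}.
Let M : structure source_sig := labelled_copy #|slot|.+2 (Defs.expand P).

Lemma sat_in_copy n k i (x : 'I_n) (v : n.-tuple M) (V : k.-tuple {set M}) :
  sat (in_copy k i x) v V = ((tnth v x).2 == copy_of i).
Proof. by rewrite /= inE. Qed.

Lemma sat_has_label n k l (x : 'I_n) (v : n.-tuple M) (V : k.-tuple {set M}) :
  sat (has_label k l x) v V = ((tnth v x).1 \in P (enum_rank l)).
Proof. by rewrite /= inE /= inE andbT. Qed.

Lemma sat_same_origin n k (x y : 'I_n) (v : n.-tuple M) (V : k.-tuple {set M}) :
  sat (same_origin k x y) v V = ((tnth v x).1 == (tnth v y).1).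
Proof. by rewrite /= inE !tnth_map !(tnth_nth x). Qed.

Lemma sat_is_end n k i (lt : i < 2) (x e : 'I_n) (v : n.-tuple M)
    (V : k.-tuple {set M}) :
  sat (is_end k lt x e) v V =
  ([tuple (tnth v x).1; (tnth v e).1] \in interp N (inr (endpoint lt))) &&
  ((tnth v x).2 == (tnth v e).2).
Proof.
rewrite /= inE /= andbT eq_sym; congr (_ && _).
have -> // : map_tuple fst (map_tuple (tnth v) [tuple x; e]) =
  [tuple (tnth v x).1; (tnth v e).1].
exact: val_inj.
Qed.

Lemma not_closed_originP (v : 2.-tuple M) (X : {set M}) :
  reflect (exists p q : M, [/\ q \in X, p.1 = q.1 & p \notin X])
    (sat not_closed_origin v [tuple X]).
Proof.
rewrite sat_exelt; apply: (iffP existsP) => -[p].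
  rewrite sat_exelt => /existsP[q];
    rewrite !sat_and sat_not !sat_mem sat_same_origin !(tnth_nth p)
      !(tnth_nth X) /=.
  by case/andP => /andP[qX /eqP e] pX; exists p, q.
case=> q [qX e pX]; exists p; rewrite sat_exelt; apply/existsP; exists q.
rewrite !sat_and sat_not !sat_mem sat_same_origin !(tnth_nth p) !(tnth_nth X)
  /=.
by rewrite qX e eqxx pX.
Qed.

Lemma not_closed_parentP i (v : 2.-tuple M) (X : {set M}) :
  reflect (exists p q e : M, [/\ q \in X /\ q.1 \notin P (enum_rank (inl i)),
    [tuple p.1; e.1] \in interp N (inr (endpoint (isT : 0 < 2))) /\ p.2 = e.2,
    [tuple q.1; e.1] \in interp N (inr (endpoint (isT : 1 < 2))) /\ q.2 = e.2 &
      p \notin X])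
    (sat (not_closed_parent i) v [tuple X]).
Proof.
rewrite sat_exelt; apply: (iffP existsP) => -[p].
  rewrite sat_exelt => /existsP[q]; rewrite sat_exelt => /existsP[e].
  rewrite !sat_and !sat_not !sat_mem !sat_is_end sat_has_label !(tnth_nth p)
    !(tnth_nth X) /=.
  case/andP => /andP[qX ql]
    /andP[/andP[/andP[pe /eqP pe2] /andP[qe /eqP qe2]] pX].
  by exists p, q, e.
case=> q [e [[qX ql] [pe pe2] [qe qe2] pX]].
exists p; rewrite sat_exelt; apply/existsP; exists q; rewrite sat_exelt;
  apply/existsP; exists e.
rewrite !sat_and !sat_not !sat_mem !sat_is_end sat_has_label !(tnth_nth p)
  !(tnth_nth X) /=.
by rewrite qX ql pe pe2 qe qe2 !eqxx.
Qed.

Lemma reachesP i (x y : M) :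
  reflect (forall X : {set M}, y \in X ->
     ~ (exists p q : M, [/\ q \in X, p.1 = q.1 & p \notin X]) ->
     ~ (exists p q e : M, [/\ q \in X /\ q.1 \notin P (enum_rank (inl i)),
    [tuple p.1; e.1] \in interp N (inr (endpoint (isT : 0 < 2))) /\ p.2 = e.2,
    [tuple q.1; e.1] \in interp N (inr (endpoint (isT : 1 < 2))) /\ q.2 = e.2 &
      p \notin X]) ->
    x \in X)
   (sat (reaches i) [tuple x; y] [tuple]).
Proof.
apply: (iffP idP).
  move=> satr X yX cl1 cl2.
  have {}cl1 := introN (not_closed_originP [tuple x; y] X) cl1.
  have {}cl2 := introN (not_closed_parentP i [tuple x; y] X) cl2;
    apply: contraLR satr => xX.
  rewrite sat_not negbK sat_exset; apply/existsP; exists X.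
  rewrite !sat_and !sat_not cl1 cl2 !sat_mem.
  rewrite !(tnth_nth x) !(tnth_nth X) andbT /=.
  by rewrite yX xX.
move=> closed; rewrite sat_not sat_exset; apply/negP => /existsP[X].
rewrite !sat_and !sat_not =>
  /andP[+ /andP[/not_closed_originP cl1 /not_closed_parentP cl2]].
rewrite !sat_mem !(tnth_nth x) !(tnth_nth X) /= => /andP[yX /negP xX].
by apply: xX; apply: closed.
Qed.
End Semantics.
End Transduction.

Section Reach.
Variables (S : signature) (K : nat) (T : tree_domain).
Let N := incidence (successor_tree T).
Variable P : 'I_#|label S K| -> {set N}.
Let M : structure (source_sig S K) :=
    labelled_copy #|slot S K|.+2 (Defs.expand P).

Lemma edge_tuple (p q : T) : edge (val p) (val q) ->
  exists c : tuples (successor_tree T), val (val c) = [:: p; q].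
Proof.
move=> pq; have /seq_inP[c ec] : [tuple p; q] \in interp (successor_tree T) tt.
  by rewrite inE.
by exists c; exact: ec.
Qed.

(** The least set as in [reaches] consists of the vertices met when climbing from
v, up to the first one labelled i. *)
Lemma sat_reaches i (u v : T) (j k : 'I_#|slot S K|.+2) :
  reflect (prefix (val u) (val v) /\
           forall w : T, prefix (val u) (val w) -> prefix (val w) (val v) ->
             w != u ->
             (inl w : N) \notin P (enum_rank (inl i)))
   (sat (reaches i) [tuple (inl u, j) : M; (inl v, k) : M] [tuple]).
Proof.
apply: (iffP (reachesP _ _ _)) => [closed|[uv free] X vX cl1 cl2]; last first.
  have step (w : T) : prefix (val u) (val w) -> prefix (val w) (val v) ->
      forall l, ((inl w, l) : M) \in X.
    move: {2}(size _ - size _).+1 (ltnSn (size (val v) - size (val w))) => m.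
    elim: m w => // m IH w lt_m uw wv l.
    have [wv_eq|wv_ne] := eqVneq w v.
      apply: contrapT => /negP wX; apply: cl1; exists (inl w, l), (inl v, k).
      by rewrite wv_eq in wX *.
    have nvw : val w != val v by [].
    have lt : size (val w) < size (val v).
      by rewrite ltnNge; apply: contra nvw => le; rewrite (prefix_anti wv le).
    have e' := edge_take wv nvw.
    pose w' : T := [` prefix_closed (prefix_take (val v) (size (val w)).+1)
      (valP v)]%fset.
    have e : edge (val w) (val w') by [].
    have uw' : prefix (val u) (val w').
      by apply: prefix_trans uw _; case/andP: e.
    have w'v : prefix (val w') (val v) by exact: prefix_take.
    have szw' : size (val w') = (size (val w)).+1 by rewrite /= size_takel.
    have w'X l' : ((inl w', l') : M) \in X.
      apply: (IH w' _ uw' w'v l').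
      by rewrite szw' subnS -ltnS prednK ?subn_gt0.
    have [c ec] := edge_tuple e.
    apply: contrapT => /negP wX; apply: cl2.
    exists (inl w, l), (inl w', l), (inr c, l); split => //.
    - split=> //; apply: free => //; apply/eqP => w'u.
      by have := size_prefix uw; rewrite -w'u szw' ltnn.
    - by split=> //; rewrite inE /= [bseqval _]ec.
    - by split=> //; rewrite inE /= [bseqval _]ec.
  by apply: (step u (prefix_refl _) uv).
(* The vertices that v can reach form one of the sets X. *)
pose X : {set M} := [set z : M | if z.1 is inl w then prefix (val w) (val v) &&
  [forall w' : T, [&& prefix (val w) (val w'), prefix (val w') (val v) &
    w' != w] ==>
     ((inl w' : N) \notin P (enum_rank (inl i)))] else false].
suff : ((inl u, j) : M) \in X.
  rewrite inE /= => /andP[uv /forallP free]; split=> // w uw wv wu.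
  by have := free w; rewrite uw wv wu.
apply: closed.
- rewrite inE /= prefix_refl; apply/forallP => w; apply/implyP => /and3P[vw wv].
  case/eqP; apply: val_inj; apply: prefix_anti wv (size_prefix vw).
- by move=> [p [q [qX e]]]; rewrite inE e; move: qX; rewrite inE => ->.
move=> [[p lp] [[q lq] [[e le]]]] /= [[qX qP] [pe _] [qe _]].
rewrite inE /=; rewrite inE /= in qX; rewrite !inE !(tnth_nth p) /= in pe qe.
case: q qX qP qe => // q /andP[qv /forallP free] qP.
case: e pe => [|c]; first by case: p.
case: p => // p /=; have [a [b [ab ->]]] := tree_tupleP c.
move=> /= /eqP[<-] /eqP[eb]; rewrite eb in ab.
have av : prefix (val a) (val v) by apply: prefix_trans qv; case/andP: ab.
case/negP; rewrite av; apply/forallP => w; apply/implyP => /and3P[aw wv wa].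
have [->//|wq] := eqVneq w q.
have qw : prefix (val q) (val w).
  apply: prefix_comparable qv wv _; move: ab => /andP[_ /eqP->].
  rewrite ltnNge; apply: contra wa => le_wa; apply/eqP/val_inj.
  exact: (esym (prefix_anti aw le_wa)).
by have := free w; rewrite qw wv wq.
Qed.
End Reach.

Section Encoding.
Variables (S : signature) (A : structure S) (D : tree_decomposition A)
    (K : nat).
Variable T : tree_domain.
Hypothesis D_T : {subset vertices (underlying D) <= vertices T}.
Variables (top : A -> underlying D) (col : A -> 'I_K)
    (loc : tuples A -> underlying D).
Hypothesis top_bag : forall a, a \in bag (top a).
Hypothesis topP : forall a (v : underlying D), a \in bag v ->
    prefix (val (top a)) (val v) /\
    forall w : underlying D, prefix (val (top a)) (val w) -> prefix (val w)
      (val v) -> a \in bag w.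
Hypothesis col_inj : forall v : underlying D, {in bag v &, injective col}.
Hypothesis loc_bag : forall c : tuples A,
    {subset (val (val c) : seq A) <= bag (loc c)}.

Let N := incidence (successor_tree T).

Definition embed (v : underlying D) : T := [` D_T (valP v)]%fset.

Lemma embed_inj : injective embed.
Proof. by move=> u v /(congr1 val) /= e; apply: val_inj. Qed.

Definition vertex_of (z : incidence A) : T :=
  match z with inl a => embed (top a) | inr c => embed (loc c) end.

Lemma colour_word_subproof (c : tuples A) : size (map col (val (val c))) <=
    max_arity S.
Proof. by rewrite size_map; exact: (valP (val c)). Qed.

Definition slot_of (z : incidence A) : slot S K :=
  match z with
  | inl a => inl (col a)
  | inr c => inr (Bseq (colour_word_subproof c))
  end.

Definition labels (r : 'I_#|label S K|) : {set N} :=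
  match enum_val r with
  | inl i => [set (inl (vertex_of z) : N) | z : incidence A & slot_of z == i]
  | inr (R, i) => [set (inl (vertex_of z) : N) | z : incidence A &
      (slot_of z == i) && ([tuple z] \in interp (incidence A) (inl R))]
  end.

Let M : structure (source_sig S K) :=
    labelled_copy #|slot S K|.+2 (Defs.expand labels).

Definition encode (z : incidence A) : M :=
    (inl (vertex_of z), copy_of (slot_of z)).

(** The coded element lies in the bag of the vertex, where colours are
injective; so do the components of a coded tuple. *)
Lemma encode_inj : injective encode.
Proof.
move=> x y e; have ev := inl_inj (congr1 fst e);
  have /copy_of_inj := congr1 snd e.
case: x y ev {e} => [a|c] [a'|c'] //= /embed_inj ev' [].
  by move=> ec; congr inl; apply: (col_inj (v := top a)); rewrite // ev'.
move=> ec.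
congr inr; apply/val_inj/val_inj;
  apply: (inj_in_map (col_inj (v := loc c))) => //.
- by rewrite inE; apply/allP => ?; apply: loc_bag.
- by rewrite inE ev'; apply/allP => ?; apply: loc_bag.
Qed.

Lemma mem_label_slot (z : N) i : (z \in labels (enum_rank (inl i))) =
  [exists x, (slot_of x == i) && (z == inl (vertex_of x))].
Proof.
rewrite /labels enum_rankK; apply/imsetP/existsP => [[x]|[x /andP[xi /eqP ->]]].
  by rewrite inE => xi ->; exists x; rewrite xi /=.
by exists x => //; rewrite inE.
Qed.

Lemma mem_label_rel (z : N) R i : (z \in labels (enum_rank (inr (R, i)))) =
  [exists x, [&& slot_of x == i, [tuple x] \in interp (incidence A) (inl R) &
    z == inl (vertex_of x)]].
Proof.
rewrite /labels enum_rankK;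
  apply/imsetP/existsP => [[x]|[x /and3P[xi xR /eqP ->]]].
  by rewrite inE => /andP[xi xR] ->; exists x; rewrite xi xR /=.
by exists x => //; rewrite inE xi.
Qed.

Lemma sat_domain (x : M) :
  reflect (exists z, x = encode z)
    (sat (bt_delta (tr_basic (decoding S K))) [tuple x] [tuple]).
Proof.
rewrite sat_some; apply: (iffP existsP) => [[i]|[z ->]].
  rewrite sat_and sat_in_copy sat_has_label !(tnth_nth x) /= mem_label_slot.
  move=> /andP[/eqP xi /existsP[z /andP[/eqP zi /eqP xz]]]; exists z.
  by rewrite /encode zi -xi -xz -surjective_pairing.
exists (slot_of z);
  rewrite sat_and sat_in_copy sat_has_label !(tnth_nth (encode z)) /= eqxx
    mem_label_slot.
by apply/existsP; exists z; rewrite !eqxx.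
Qed.

Lemma sat_relation R (z : incidence A) :
  sat (target_interp K (inl R : symbol (incidence_sig S)))
    ([tuple encode z] : 1.-tuple M) [tuple] =
  ([tuple z] \in interp (incidence A) (inl R)).
Proof.
rewrite sat_some; apply/existsP/idP => [[i]|zR].
  rewrite sat_and sat_in_copy sat_has_label !(tnth_nth (encode z)) /=
    mem_label_rel.
  case/andP => /eqP/copy_of_inj zi /existsP[x /and3P[/eqP xi xR /eqP zx]].
  suff -> : z = x by [].
  by apply: encode_inj; rewrite /encode zi xi zx.
exists (slot_of z);
  rewrite sat_and sat_in_copy sat_has_label !(tnth_nth (encode z)) /= eqxx
    mem_label_rel.
by apply/existsP; exists z; rewrite zR !eqxx.
Qed.

(** Let a' be the component of c with the colour of a.  If the climb from the
vertex of c ends at top a, then top a' is not strictly below top a, for it is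
labelled by this colour.  In both remaining cases a and a' share the bag of
top a and hence are equal.  Conversely, if some b of the same colour as a were
introduced strictly below top a on the path to the vertex of c, then b and a
would share the bag of top b. *)
Lemma sat_incidence (j : 'I_(max_arity S)) (x y : incidence A) :
  sat (target_interp K (inr j : symbol (incidence_sig S)))
    ([tuple encode x; encode y] : 2.-tuple M) [tuple] =
  ([tuple x; y] \in interp (incidence A) (inr j)).
Proof.
have -> : ([tuple x; y] \in interp (incidence A) (inr j)) =
    if (x, y) is (inl a, inr c) then onth (val c) j == Some a else false.
  by rewrite inE !(tnth_nth x).
rewrite sat_some; apply/existsP/idP.
  move=> [[i w]]; rewrite !sat_and !sat_in_copy.
  case/andP=> ewi /andP[/andP[/eqP xi /eqP yw]] reach.
  have {}xi : slot_of x = inl i := copy_of_inj xi.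
  have {}yw : slot_of y = inr w := copy_of_inj yw.
  case: x y xi yw reach => [a|//] [//|c] [ai] [cw] reach.
  have [uv free] := elimT (sat_reaches labels (inl i) (embed (top a))
    (embed (loc c)) _ _) reach.
  move: ewi; rewrite -cw onth_map; case ec: (onth _ _) => [a'|//] /= /eqP[a'i].
  have a'c : a' \in bag (loc c) by apply: loc_bag; apply/onthP; exists (val j).
  have [ta'c below] := topP a'c.
  have [ta'a|ta'a] := leqP (size (val (top a))) (size (val (top a'))).
    have taa' : prefix (val (top a))
      (val (top a')) by apply: prefix_comparable ta'c ta'a.
    have [e|ne] := eqVneq (top a') (top a).
      apply/eqP; congr Some; apply: (col_inj (v := top a)) => //;
        first by rewrite -e.
      by rewrite a'i ai.
    have := free (embed (top a')) taa' ta'c;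
      rewrite (inj_eq embed_inj) ne => /(_ isT).
    rewrite mem_label_slot => /existsP[]; exists (inl a').
    by rewrite /= eqxx andbT a'i.
  have taa' : prefix (val (top a'))
    (val (top a)) by apply: prefix_comparable ta'c uv (ltnW _).
  have a'a := below _ taa' uv.
  by apply/eqP; congr Some; apply: (col_inj (v := top a)) => //; rewrite a'i ai.
case: x => [a|//]; case: y => [//|c] /eqP ec.
exists (col a, Bseq (colour_word_subproof c)).
apply/andP; split; first by rewrite [onth _ _]onth_map ec.
rewrite !sat_and !sat_in_copy; apply/andP; split.
  by apply/andP; split; apply/eqP.
have ac : a \in bag (loc c) by apply: loc_bag; apply/onthP; exists (val j).
have [tac below] := topP ac.
apply/sat_reaches; split=> // w taw wc nw; rewrite mem_label_slot;
  apply/existsP => -[z].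
case/andP => zi /eqP[ew]; case: z zi ew => [b|//] /= /eqP[ba] ew.
rewrite ew in taw wc nw.
have [tb _] := topP (top_bag b).
have ab := below _ taw wc.
case/negP: nw; apply/eqP; congr embed; congr top.
exact: (col_inj (v := top b)).
Qed.

(** The map [encode] is a bijection onto the domain of the transduction, and it
respects the relations. *)
Lemma decoding_encodes : transduce (decoding S K) (incidence (successor_tree T))
    (incidence A).
Proof.
exists labels; split; first exact: sat_true.
apply: iso_sym.
have dom z : sat (bt_delta (tr_basic (decoding S K)))
  ([tuple encode z] : 1.-tuple M) [tuple].
  by apply/sat_domain; exists z.
exists (fun z => exist _ (encode z) (dom z)).
  apply: inj_card_bij => [x y /(congr1 val)|]; first exact: encode_inj.
  rewrite -(card_codom (f := fun z => exist _ (encode z) (dom z) :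
    bt_domain (tr_basic (decoding S K)) M)); last first.
    by move=> x y /(congr1 val); exact: encode_inj.
  apply/subset_leq_card/fintype.subsetP => -[x dx] _.
  have /sat_domain[z ez] := dx; apply/codomP; exists z; exact: val_inj.
case=> [R|j] t; rewrite inE.
  case/tupleP: t => z t.
  have -> : [tuple of z :: t] = [tuple z] by apply: val_inj;
    rewrite /= (tuple0 t).
  rewrite -sat_relation.
  by congr (sat _ _ _); apply: val_inj.
case/tupleP: t => x t; case/tupleP: t => y t.
have -> : [tuple of x :: [tuple of y :: t]] = [tuple x; y].
  by apply: val_inj; rewrite /= (tuple0 t).
rewrite -sat_incidence.
by congr (sat _ _ _); apply: val_inj.
Qed.
End Encoding.

(** * The theorem *)

Lemma transduction_of_decompositions (S : signature) (C : class S)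
    (K : class graph_sig) n :
  (forall A, C A -> exists D : tree_decomposition A,
    (forall v : underlying D, #|bag v| <= n.+1) /\
    exists2 T, K (successor_tree T) &
      {subset vertices (underlying D) <= vertices T}) ->
  incidence_transducible C K.
Proof.
move=> decs; exists (decoding S n.+1) => B [A CA isoB].
have [D [le_n [T KT D_T]]] := decs A CA.
exists (incidence (successor_tree T)); first by exists (successor_tree T);
  last exact: iso_refl.
have [top topP] := fin_all_exists (@top_exists _ _ D).
have [||col colP] := colouring_exists (top := top) le_n.
- by move=> a; case: (topP a).
- by move=> a; case: (topP a).
have /fin_all_exists[loc locP] (c : tuples A) : exists v : underlying D,
    {subset (val (val c) : seq A) <= bag v}.
  case: c => c /= /existsP[R /existsP[t /andP[tR /eqP <-]]].
  exact: (bag_tuple D tR).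
have [P [def isoA]] := decoding_encodes D_T (fun a => proj1 (topP a))
  (fun a => proj2 (topP a)) colP locP.
by exists P; split=> //; apply: iso_trans isoA isoB.
Qed.

(** The common form of the three equivalences. *)
Lemma transducible_iff_width (S : signature) (C : class S) (K : class graph_sig)
    (Q : tree_domain -> Prop) :
  (forall G, K G -> exists2 T, Q T & G = successor_tree T) ->
  (forall T, Q T -> exists2 T', K (successor_tree T') &
     {subset vertices T <= vertices T'}) ->
  incidence_transducible C K <-> (class_width (@min_width Q S) C < +oo)%E.
Proof.
move=> K_tree embeds; split=> [tr|/class_width_lt[n decs]].
  by apply/class_width_lt; apply: decompositions_of_transduction tr.
apply: (transduction_of_decompositions (n := n)) => A CA.
have [D [QD le_n]] := decs A CA; exists D; split; last exact: embeds.
by move=> v; apply: leqW.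
Qed.

Lemma height_complete_tree m n : height (complete_tree m n) <= n.
Proof.
apply/bigmax_leqP => v _; have := valP v.
by rewrite [_ \in _]in_complete_vertices => /andP[].
Qed.

Lemma sub_complete_tree (T : tree_domain) n : height T <= n ->
  exists m, {subset vertices T <= vertices (complete_tree m n)}.
Proof.
move=> le_n; exists (\max_(v : T) \max_(d <- val v) d.+1) => x xT.
rewrite in_complete_vertices; apply/andP; split.
  apply: leq_trans le_n;
    exact: (leq_bigmax (F := fun v : T => (size (val v)).+1) [` xT]%fset).
apply/allP => d dx.
apply: leq_trans (leq_bigmax (F := fun v :
  T => \max_(d <- val v) d.+1) [` xT]%fset).
exact: (leq_bigmax_seq (F := succn) d dx isT).
Qed.

Theorem theorem7p1 (S : signature) (C : class S) :
  (incidence_transducible C paths <-> (class_width (@pwd S) C < +oo)%E) /\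
  (incidence_transducible C trees <-> (class_width (@twd S) C < +oo)%E) /\
  (forall n : nat,
     incidence_transducible C (complete_trees n) <->
     (class_width (@twdn n S) C < +oo)%E).
Proof.
split; last split => [|n]; apply: transducible_iff_width.
- by move=> G [T pathT ->]; exists T.
- by move=> T pathT; exists T => //; exists T.
- by move=> G [T ->]; exists T.
- by move=> T _; exists T => //; exists T.
- by move=> G [m ->]; exists (complete_tree m n);
    first exact: height_complete_tree.
- by move=> T /sub_complete_tree[m sub]; exists (complete_tree m n) => //;
    exists m.
Qed.
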